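(* Let $\boldsymbol{a}$ be a weak composition of $r$ of length $k$ and $\boldsymbol{b}$ a weak composition of $s$ of length $m$. The set $\{\mathcal{D}_{\hat\pi}:\hat\pi\in\hat\Pi_{2(\boldsymbol{a},\boldsymbol{b})}\}$ forms a basis for $\mathrm{MP}_{\boldsymbol{a},\boldsymbol{b}}(x)$ (as a vector space over $\mathbb{C}(x)$, the elements $\mathcal{D}_{\hat\pi}$ being indexed by $\hat\Pi_{2(\boldsymbol{a},\boldsymbol{b})}$).
   Context: **Partition algebra.** For $q\ge 0$ let $\Pi_{2q}$ be the set of set partitions of $[q]\cup[\underline{q}]=\{1,\dots,q\}\cup\{\underline1,\dots,\underline q\}$. For an indeterminate $x$, the partition algebra $P_q(x)$ is the associative $\mathbb{C}(x)$-algebra with basis $\{\mathcal{L}_\pi:\pi\in\Pi_{2q}\}$ and product $\mathcal{L}_\pi\mathcal{L}_\nu=x^{c(\pi,\nu)}\mathcal{L}_{\pi\circ\nu}$: draw $\pi$ as a graph with top vertices $1,\dots,q$ and bottom vertices $\underline1,\dots,\underline q$ whose connected components are the blocks, place $\pi$ above $\nu$, identify the bottom vertices of $\pi$ with the corresponding top vertices of $\nu$; $\pi\circ\nu$ is the set partition induced on the very top and very bottom vertices, and $c(\pi,\nu)$ is the number of components lying entirely in the middle row. The group algebra $\mathbb{C}S_q$ embeds in $P_q(x)$ by sending $\sigma$ to $\mathcal{L}_{\{\{\sigma(1),\underline1\},\dots,\{\sigma(q),\underline q\}\}}$. **Alphabets.** A weak composition of $r$ of length $k$ is a sequence of $k$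 non-negative integers with sum $r$. We use four disjoint alphabets: $i$ (plain), $\overline{i}$ (barred), $\underline{i}$ (underlined), $\underline{\overline{i}}$ (barred and underlined), $i\ge1$, where $\overline i$ and $\underline{\overline i}$ are called barred. Each alphabet is ordered as the integers, and $i<\overline{j}<\underline{k}<\underline{\overline{m}}$ for all $i,j,k,m$. $[k]^{\boldsymbol a}$ is the multiset in which $i$ has multiplicity $\boldsymbol a_i$, and $[\overline m]^{\boldsymbol b}$, $[\underline k]^{\boldsymbol a}$, $[\underline{\overline m}]^{\boldsymbol b}$ are defined likewise. A multiset partition of a multiset is a multiset of nonempty multisets (blocks) whose multiset union is the given one. $\hat\Pi_{2(\boldsymbol a,\boldsymbol b)}$ is the set of multiset partitions of $[k]^{\boldsymbol a}\uplus[\overline m]^{\boldsymbol b}\uplus[\underline k]^{\boldsymbol a}\uplus[\underline{\overline m}]^{\boldsymbol b}$ such that no barred symbol is repeated inside a block ($\overline i$ and $\underline{\overline i}$ are different symbols) and every block occurring more than once has an even number of barred entries. **Coloring map.** $\kappa_{\boldsymbol a,\boldsymbol b}:[r+s]\to[k]\cup[\overline m]$ is the weakly increasing map taking each value $i\in[k]$ exactly $\boldsymbol a_i$ times and each value $\overline j\in[\overline m]$ exactly $\boldsymbol b_j$ times (so $1,\dots,r$ go to plain values and $r+1,\dots,r+s$ to barred values). Put $\kappa_{\boldsymbol a,\boldsymbol b}(\underline i)=\underline{\kappa_{\boldsymbol a,\boldsymbol b}(i)}$, and apply $\kappa_{\boldsymbol a,\boldsymbol b}$ to a set partition in $\Pi_{2(r+s)}$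 by applying it to every element of every block (producing a multiset of multisets). **The algebra.** $S_{\boldsymbol a}\times S_{\boldsymbol b}\subseteq S_{r+s}$ is the subgroup of permutations preserving every fibre of $\kappa_{\boldsymbol a,\boldsymbol b}$; its elements are written $\sigma\tau$, with $\sigma\in S_{\boldsymbol a}$ permuting $\{1,\dots,r\}$ and $\tau\in S_{\boldsymbol b}$ permuting $\{r+1,\dots,r+s\}$. Let $$e_{\boldsymbol a,\boldsymbol b}=\frac{1}{|S_{\boldsymbol a}\times S_{\boldsymbol b}|}\sum_{\sigma\tau\in S_{\boldsymbol a}\times S_{\boldsymbol b}}\operatorname{sgn}(\tau)\,\sigma\tau\in\mathbb{C}S_{r+s}\subseteq P_{r+s}(x),$$ an idempotent, and define $\mathrm{MP}_{\boldsymbol a,\boldsymbol b}(x)=e_{\boldsymbol a,\boldsymbol b}P_{r+s}(x)e_{\boldsymbol a,\boldsymbol b}$. **Basis elements.** Last-letter order on multisets over a totally ordered alphabet: $\tilde S<\tilde R$ if $\tilde S$ is empty and $\tilde R$ is not, or $\max\tilde S<\max\tilde R$, or $\max\tilde S=\max\tilde R=u$ and $\tilde S\smallsetminus\{u\}<\tilde R\smallsetminus\{u\}$. The standardization $\pi\in\Pi_{2(r+s)}$ of $\hat\pi\in\hat\Pi_{2(\boldsymbol a,\boldsymbol b)}$ is obtained by listing the blocks of $\hat\pi$ in weakly increasing last-letter order and, for each symbol, replacing its occurrences from left to right by the elements of its preimage under $\kappa_{\boldsymbol a,\boldsymbol b}$ in increasing order; it satisfies $\kappa_{\boldsymbol a,\boldsymbol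 b}(\pi)=\hat\pi$. Define $\mathcal{D}_{\hat\pi}=e_{\boldsymbol a,\boldsymbol b}\,\mathcal{L}_\pi\,e_{\boldsymbol a,\boldsymbol b}$. *)

(* Defs.v *)
From HB Require Import structures.
From mathcomp Require Import all_boot all_order all_fingroup all_algebra all_field.
From mathcomp Require Import finmap multiset complex reals.

Set Implicit Arguments.
Unset Strict Implicit.
Unset Printing Implicit Defensive.

Import GRing.Theory.
Local Open Scope ring_scope.

Definition is_middle (A B : Type) (y : A + B) := if y is inr _ then true else false.

(* The component of x only has middle vertices. *)
Definition in_middle (A B : finType) (e : rel (A + B)) : pred (A + B) :=
  fun x => connect e x \subset [pred y | is_middle y].

Section Diagrams.
Variable q : nat.

(* Top vertices are inl i, bottom vertices are inr i. *)
Definition vtx := ('I_q + 'I_q)%type.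
Definition setpart := {P : {set {set vtx}} | partition P [set: vtx]}.
Implicit Types (pi nu rho : setpart) (v w : vtx).

Definition same_block pi v w := w \in pblock (val pi) v.

(* The graph of pi, its vertices being placed in T by f. *)
Definition drawn (T : finType) (f : vtx -> T) pi : rel T :=
  fun x y => [exists v, exists w, [&& f v == x, f w == y & same_block pi v w]].

(* Stacking pi above nu: the outer vertices are inl v, the middle row is inr i. *)
Definition upper v : vtx + 'I_q :=
  match v with inl i => inl (inl i) | inr i => inr i end.
Definition lower v : vtx + 'I_q :=
  match v with inl i => inr i | inr i => inl (inr i) end.

Definition stacked pi nu := relU (drawn upper pi) (drawn lower nu).

Definition outer_rel pi nu v w := connect (stacked pi nu) (inl v) (inl w).

Lemma same_block_equiv pi : equivalence_rel (same_block pi).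
Proof.
move=> v w z; case/and3P: (valP pi) => /eqP cov triv _.
have inc u : u \in cover (val pi) by rewrite cov inE.
rewrite /same_block mem_pblock inc; split=> // vw.
by rewrite (same_pblock triv vw).
Qed.

Lemma same_blockxx pi v : same_block pi v v.
Proof. by case: (same_block_equiv pi v v v). Qed.

Lemma same_block_sym pi : symmetric (same_block pi).
Proof.
suff H v w : same_block pi v w -> same_block pi w v.
  by move=> v w; apply/idP/idP; exact: H.
move=> vw; have [_ /(_ vw) <-] := same_block_equiv pi v w v.
exact: same_blockxx.
Qed.

Lemma drawn_sym (T : finType) (f : vtx -> T) pi : symmetric (drawn f pi).
Proof.
suff H x y : drawn f pi x y -> drawn f pi y x by move=> x y; apply/idP/idP; exact: H.
case/existsP=> v /existsP[w /and3P[Hv Hw vw]].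
by apply/existsP; exists w; apply/existsP; exists v; rewrite Hv Hw same_block_sym.
Qed.

Lemma stacked_sym pi nu : symmetric (stacked pi nu).
Proof. by move=> x y; congr (_ || _); exact: drawn_sym. Qed.

Lemma outer_equiv pi nu : {in [set: vtx] & &, equivalence_rel (outer_rel pi nu)}.
Proof.
move=> u v w _ _ _; split; first exact: connect0.
by move=> uv; exact: (same_connect (sym_connect_sym (stacked_sym pi nu)) uv (inl w)).
Qed.

Definition compose pi nu : setpart :=
  exist _ (equivalence_partition (outer_rel pi nu) [set: vtx])
    (equivalence_partitionP (@outer_equiv pi nu)).

(* The number of components lying entirely in the middle row. *)
Definition n_middle pi nu := n_comp (stacked pi nu) (in_middle (stacked pi nu)).

Lemma setpart_inj pi nu : same_block pi =2 same_block nu -> pi = nu.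
Proof.
move=> eq_pn; apply: val_inj.
rewrite -(equivalence_partition_pblock (valP pi)).
rewrite -(equivalence_partition_pblock (valP nu)).
by apply: eq_imset => v; apply/setP=> w; rewrite !inE /=; exact: eq_pn.
Qed.

Lemma same_compose pi nu v w :
  same_block (compose pi nu) v w = outer_rel pi nu v w.
Proof.
by rewrite /same_block (pblock_equivalence_partition (@outer_equiv pi nu)) ?inE.
Qed.
End Diagrams.
(* Contracting, in the graph of e1 and e2 on T, the components of e1: h embeds the
   vertices that remain, and eW is the contracted graph. *)
Section Contract.
Variables (T W : finType) (e1 e2 : rel T) (h : W -> T) (eW : rel W).
Hypotheses (e1_sym : symmetric e1) (e2_sym : symmetric e2) (eW_sym : symmetric eW).
Let E := relU e1 e2.
Hypothesis eW_E : forall w w', eW w w' -> connect E (h w) (h w').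
Hypothesis e1_eW : forall w w', connect e1 (h w) (h w') -> connect eW w w'.
Hypothesis e2_eW : forall x y, e2 x y ->
  exists w, exists w', [/\ x = h w, y = h w' & connect eW w w'].

Let E_sym : symmetric E. Proof. by move=> x y; congr (_ || _). Qed.
Let cE := sym_connect_sym E_sym.
Let ce1 := sym_connect_sym e1_sym.
Let ceW := sym_connect_sym eW_sym.

Lemma sub_e1E x y : connect e1 x y -> connect E x y.
Proof. by apply: connect_sub => {x y} x y xy; apply: connect1; rewrite /= xy. Qed.

Lemma contract_path w y : connect E (h w) y ->
  exists2 w', connect eW w w' & connect e1 (h w') y.
Proof.
case/connectP=> p; elim/last_ind: p y => [|p z IH] y /=.
  by move=> _ ->; exists w; exact: connect0.
rewrite rcons_path last_rcons => /andP[/IH /(_ erefl) [w' ww' w'l] /orP[H|H]] ->.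
  by exists w' => //; apply: connect_trans w'l (connect1 H).
have [w1 [w2 [d1 d2 w12]]] := e2_eW H.
exists w2; last by rewrite d2.
apply: connect_trans ww' (connect_trans _ w12).
by apply: e1_eW; rewrite -d1.
Qed.

Lemma contract_connect w w' : connect E (h w) (h w') = connect eW w w'.
Proof.
apply/idP/idP.
  by case/contract_path=> w1 ww1 /e1_eW; apply: connect_trans.
case/connectP=> p; elim: p w => [|z p IH] w /=; first by move=> _ ->.
by case/andP=> /eW_E wz pz dw'; apply: connect_trans wz (IH _ pz dw').
Qed.

Definition touch x := [exists w, connect e1 x (h w)].

Lemma touch_closed : closed e1 touch.
Proof.
move=> x y xy; rewrite !unfold_in; apply: eq_existsb => w.
exact: (same_connect1 ce1 xy).
Qed.

Lemma ntouch_connect x : ~~ touch x -> connect E x =1 connect e1 x.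
Proof.
move=> nx y; apply/idP/idP; last exact: sub_e1E.
case/connectP=> p; elim/last_ind: p y => [|p z IH] y /=.
  by move=> _ ->; exact: connect0.
rewrite rcons_path last_rcons => /andP[/IH /(_ erefl) xl /orP[H|H]] ->.
  by apply: connect_trans xl (connect1 H).
have [w1 [w2 [d1 d2 w12]]] := e2_eW H.
by case/negP: nx; apply/existsP; exists w1; rewrite -d1.
Qed.

Lemma touchE_closed : closed E touch.
Proof.
apply: (intro_closed cE) => x y xy tx; apply: contraT => ny.
have yx : connect e1 y x by rewrite -(ntouch_connect ny) connect1 // E_sym.
by move: ny; rewrite (closed_connect touch_closed yx) tx.
Qed.

Lemma contract_count (a : pred T) : closed E a ->
  (forall x, ~~ touch x -> a x) ->
  n_comp E a = (n_comp eW [preim h of a] + n_comp e1 [predC touch])%N.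
Proof.
move=> cla na.
pose b := [predI a & touch].
have clb : closed E b.
  by move=> x y xy; rewrite !inE; congr (_ && _); [exact: cla | exact: touchE_closed].
have -> : n_comp E a = (n_comp E b + n_comp E [predC touch])%N.
  rewrite /n_comp_mem -(cardID touch); congr (_ + _)%N; apply: eq_card => x; rewrite !inE.
    by rewrite -andbA.
  have [tx|tx] := boolP (x \in touch); first by rewrite /= ?andbF.
  have ax : x \in a by exact: na.
  by rewrite /= ax !andbT.
congr (_ + _)%N.
  rewrite (@adjunction_n_comp _ _ h E eW cE ceW b clb); last first.
    split=> [x bx|x y _].
      apply/sigW; have {bx} /andP[_ /existsP[w xw]] := bx.
      by exists w; exact: sub_e1E.
    by rewrite contract_connect.
  apply: eq_n_comp_r => w; rewrite !inE /=.
  suff -> : h w \in touch by rewrite andbT.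
  by apply/existsP; exists w; exact: connect0.
rewrite /n_comp_mem; apply: eq_card => x; rewrite !inE.
case: (boolP (x \in touch)) => [|nx]; rewrite ?andbF //= !andbT.
have er : fingraph.root E x = fingraph.root e1 x.
  by rewrite /fingraph.root; congr odflt; apply: eq_pick; exact: ntouch_connect.
by congr (_ == x).
Qed.
End Contract.


(* Three stacked diagrams, drawn on four rows: inl is the top and bottom rows, inr
   the two middle ones. The map g places the pair that is composed first, and h the
   diagrams obtained after this composition. *)
Section Assoc.
Variable q : nat.
Local Notation vtx := (vtx q).
Local Notation T := (vtx + vtx)%type.
Local Notation W := (vtx + 'I_q)%type.
Variables (pi nu rho : setpart q) (g h : W -> T) (o1 o2 : vtx -> W).
Hypotheses (g_inj : injective g) (h_inj : injective h).
Hypothesis o1_inj : injective o1.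
Hypothesis gh : forall v, h (o1 v) = g (inl v).
Hypothesis cap : forall w j, h w <> g (inr j).
Hypothesis cov : forall x, (exists w, x = h w) \/ (exists j, x = g (inr j)).
Hypothesis g_inner : forall j, is_middle (g (inr j)).
Hypothesis h_outer : forall v, h (inl v) = inl v.
Hypothesis h_inner : forall i, is_middle (h (inr i)).

Let e1 := relU (drawn (g \o @upper q) pi) (drawn (g \o @lower q) nu).
Let e2 := drawn (h \o o2) rho.
Let E := relU e1 e2.
Let eW := relU (drawn o1 (compose pi nu)) (drawn o2 rho).
Let S := stacked pi nu.

Let e1_sym : symmetric e1.
Proof. by move=> x y; congr (_ || _); exact: drawn_sym. Qed.
Let e2_sym : symmetric e2. Proof. exact: drawn_sym. Qed.
Let eW_sym : symmetric eW.
Proof. by move=> x y; congr (_ || _); exact: drawn_sym. Qed.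
Let E_sym : symmetric E.
Proof. by move=> x y; congr (_ || _); [exact: e1_sym | exact: e2_sym]. Qed.

Lemma drawn_comp (T1 T2 : finType) (k : T1 -> T2) (f : vtx -> T1) (p : setpart q) x y :
  drawn (k \o f) p x y -> exists u, exists u', [/\ x = k u, y = k u' & drawn f p u u'].
Proof.
case/existsP=> v /existsP[w /and3P[/eqP <- /eqP <- vw]].
exists (f v), (f w); split=> //.
by apply/existsP; exists v; apply/existsP; exists w; rewrite !eqxx.
Qed.

Lemma drawn_map (T1 T2 : finType) (k : T1 -> T2) (f : vtx -> T1) (p : setpart q) u u' :
  drawn f p u u' -> drawn (k \o f) p (k u) (k u').
Proof.
case/existsP=> v /existsP[w /and3P[/eqP <- /eqP <- vw]].
by apply/existsP; exists v; apply/existsP; exists w; rewrite !eqxx.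
Qed.

Lemma drawnP (T1 : finType) (f : vtx -> T1) (p : setpart q) v w :
  same_block p v w -> drawn f p (f v) (f w).
Proof.
by move=> vw; apply/existsP; exists v; apply/existsP; exists w; rewrite !eqxx.
Qed.

Let e1_g x y : e1 x y -> exists u, exists u', [/\ x = g u, y = g u' & S u u'].
Proof.
by case/orP=> /drawn_comp[u [u' [-> -> uu']]]; exists u, u'; split=> //;
   rewrite /S /= uu' ?orbT.
Qed.

Let S_e1 u u' : connect S u u' -> connect e1 (g u) (g u').
Proof.
case/connectP=> p; elim: p u => [|z p IH] u /=; first by move=> _ ->; exact: connect0.
case/andP=> uz pz du'; apply: connect_trans (IH _ pz du').
by apply: connect1; case/orP: uz => /(drawn_map g) H; rewrite /e1 /= H ?orbT.
Qed.

Let ce1_g x y : connect e1 x y ->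
  x = y \/ exists u, exists u', [/\ x = g u, y = g u' & connect S u u'].
Proof.
case/connectP=> p; elim/last_ind: p y => [|p z IH] y /=; first by left.
rewrite rcons_path last_rcons => /andP[/IH /(_ erefl) + /e1_g [u [u' [lu zu' uu']]]] yz.
rewrite yz zu' {y yz}; case=> [xl|[u1 [u2 [xu1 lu2 u12]]]]; right.
  by exists u, u'; split; [rewrite xl | | exact: connect1].
exists u1, u'; split=> //.
have := lu2; rewrite lu => /g_inj E2; move: uu'; rewrite E2 => uu'.
apply: connect_trans u12 _; exact: connect1.
Qed.

Let gS u u' : connect e1 (g u) (g u') = connect S u u'.
Proof.
apply/idP/idP; last exact: S_e1.
case/ce1_g => [/g_inj ->|[u1 [u2 [/g_inj -> /g_inj ->]]] //]; exact: connect0.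
Qed.

Let hg w u : h w = g u -> exists2 v, u = inl v & w = o1 v.
Proof.
case: u => [v|j]; last by move/cap.
by rewrite -gh => /h_inj ->; exists v.
Qed.

Let H1 w w' : eW w w' -> connect E (h w) (h w').
Proof.
case/orP=> [/existsP[v /existsP[v' /and3P[/eqP <- /eqP <-]]]|].
  rewrite same_compose !gh -/S => vv'.
  by apply: sub_e1E; apply: S_e1.
by move/(drawn_map h) => H; apply: connect1; apply/orP; right.
Qed.

Let H2 w w' : connect e1 (h w) (h w') -> connect eW w w'.
Proof.
case/ce1_g => [/h_inj ->|]; first exact: connect0.
case=> u [u' [/hg[v -> ->] /hg[v' -> ->] vv']].
apply: connect1; apply/orP; left; apply: drawnP.
by rewrite same_compose.
Qed.

Let H3 x y : e2 x y -> exists w, exists w', [/\ x = h w, y = h w' & connect eW w w'].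
Proof.
case/drawn_comp=> w [w' [-> -> ww']]; exists w, w'; split=> //.
by apply: connect1; rewrite /= ww' orbT.
Qed.

Lemma assoc_outer v w :
  connect E (inl v) (inl w) = connect eW (inl v) (inl w).
Proof. by rewrite -!h_outer; apply: (contract_connect H1 H2 H3). Qed.

Lemma in_middle_closed (A B : finType) (e : rel (A + B)) :
  symmetric e -> closed e (in_middle e).
Proof.
move=> e_sym x y xy; rewrite !unfold_in /in_middle.
by apply: eq_subset => z; exact: (same_connect1 (sym_connect_sym e_sym) xy).
Qed.

Lemma assoc_count :
  n_comp E (in_middle E) = (n_comp S (in_middle S) + n_comp eW (in_middle eW))%N.
Proof.
have nin x : ~~ touch e1 h x -> is_middle x.
  case: (cov x) => [[w ->]|[j ->]] //.
  by case/existsP; exists w; exact: connect0.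
have cS := sym_connect_sym (@stacked_sym q pi nu).
have ce1 := sym_connect_sym e1_sym.
rewrite addnC (contract_count e1_sym e2_sym eW_sym H1 H2 H3).
- congr (_ + _)%N.
    apply: eq_n_comp_r => w; rewrite !inE !unfold_in.
    apply/subsetP/subsetP => sub y.
      move=> wy; have := sub (h y); rewrite !inE.
      rewrite (contract_connect H1 H2 H3) => /(_ wy).
      by case: y {wy} => // v; rewrite h_outer.
    move/(contract_path H2 H3) => [w' ww'].
    case: (cov y) => [[w'' ->]|[j ->] _]; last by rewrite inE.
    move/H2 => w'w''.
    have := sub w'' (connect_trans ww' w'w''); rewrite !inE.
    by case: w'' {w'w''} => // i.
  have clt := predC_closed (touch_closed h e1_sym).
  rewrite (adjunction_n_comp g ce1 cS clt).
    apply: eq_n_comp_r => u; rewrite !inE !unfold_in.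
    apply/existsPn/subsetP => [nt [v uv|j _] //|sub w].
      by have := nt (o1 v); rewrite gh S_e1.
    apply/negP => /ce1_g [|[u1 [u2 [/g_inj du]]]].
      by move/esym/hg=> [v du _]; have := sub u (connect0 _ _); rewrite du.
    by move/hg=> [v dv _]; rewrite -du dv => /sub.
  split=> [x ntx|u u' _]; last exact/esym/gS.
  apply/sigW; case: (cov x) => [[w dx]|[j ->]]; last by exists (inr j); exact: connect0.
  by case/existsP: ntx; exists w; rewrite dx; exact: connect0.
- exact: in_middle_closed.
move=> x ntx; apply/subsetP=> y.
rewrite !inE (ntouch_connect H3 ntx) => xy; apply: nin.
have ty : (y \in touch e1 h) = false.
  by rewrite -(closed_connect (touch_closed h e1_sym) xy); exact/negbTE.
exact/negbT.
Qed.
End Assoc.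

Section Monoid.
Variable q : nat.
Local Notation vtx := (vtx q).
Local Notation T := (vtx + vtx)%type.
Local Notation W := (vtx + 'I_q)%type.
Implicit Types (pi nu rho : setpart q).

Let gL (w : W) : T := match w with
  | inl (inl i) => inl (inl i) | inl (inr i) => inr (inr i) | inr i => inr (inl i) end.
Let hL (w : W) : T := match w with inl v => inl v | inr i => inr (inr i) end.
Let gR (w : W) : T := match w with
  | inl (inl i) => inr (inl i) | inl (inr i) => inl (inr i) | inr i => inr (inr i) end.
Let hR (w : W) : T := match w with inl v => inl v | inr i => inr (inl i) end.

Let gL_inj : injective gL. Proof. by move=> [[i|i]|i] [[j|j]|j] //= [->]. Qed.
Let gR_inj : injective gR. Proof. by move=> [[i|i]|i] [[j|j]|j] //= [->]. Qed.
Let hL_inj : injective hL. Proof. by move=> [v|i] [w|j] //= [->]. Qed.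
Let hR_inj : injective hR. Proof. by move=> [v|i] [w|j] //= [->]. Qed.
Let ghL v : hL (upper v) = gL (inl v). Proof. by case: v. Qed.
Let ghR v : hR (lower v) = gR (inl v). Proof. by case: v. Qed.
Let capL w j : hL w <> gL (inr j). Proof. by case: w. Qed.
Let capR w j : hR w <> gR (inr j). Proof. by case: w. Qed.
Let covL x : (exists w, x = hL w) \/ (exists j, x = gL (inr j)).
Proof.
by case: x => [v|[i|i]]; [left; exists (inl v)|right; exists i|left; exists (inr i)].
Qed.
Let covR x : (exists w, x = hR w) \/ (exists j, x = gR (inr j)).
Proof.
by case: x => [v|[i|i]]; [left; exists (inl v)|left; exists (inr i)|right; exists i].
Qed.

Let EL pi nu rho := relU (relU (drawn (gL \o @upper q) pi) (drawn (gL \o @lower q) nu))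
  (drawn (hL \o @lower q) rho).
Let ER pi nu rho := relU (relU (drawn (gR \o @upper q) nu) (drawn (gR \o @lower q) rho))
  (drawn (hR \o @upper q) pi).

Lemma eq_drawn (T1 : finType) (f1 f2 : vtx -> T1) pi :
  f1 =1 f2 -> drawn f1 pi =2 drawn f2 pi.
Proof.
by move=> ef x y; apply: eq_existsb => v; apply: eq_existsb => w; rewrite !ef.
Qed.

Let ELR pi nu rho : EL pi nu rho =2 ER pi nu rho.
Proof.
move=> x y; rewrite /EL /ER /=.
rewrite (@eq_drawn _ (gL \o @upper q) (hR \o @upper q)); last by case.
rewrite (@eq_drawn _ (gL \o @lower q) (gR \o @upper q)); last by case.
rewrite (@eq_drawn _ (hL \o @lower q) (gR \o @lower q)); last by case.
by rewrite -orbA orbC.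
Qed.

Let stackC pi nu : relU (drawn (@lower q) nu) (drawn (@upper q) pi) =2 stacked pi nu.
Proof. by move=> x y; exact: orbC. Qed.

Let eq_in_middle (A B : finType) (e e' : rel (A + B)) : e =2 e' -> in_middle e =i in_middle e'.
Proof.
move=> ee x; apply: eq_subset => y; exact: (eq_connect ee x y).
Qed.

Let eq_count (A B : finType) (e e' : rel (A + B)) : e =2 e' ->
  n_comp e (in_middle e) = n_comp e' (in_middle e').
Proof.
move=> ee; rewrite (eq_n_comp_r (eq_in_middle ee)).
exact: (eq_n_comp (eq_connect ee)).
Qed.

Lemma composeA pi nu rho :
  compose (compose pi nu) rho = compose pi (compose nu rho).
Proof.
apply: setpart_inj => v w; rewrite !same_compose /outer_rel.
have L := @assoc_outer q pi nu rho gL hL (@upper q) (@lower q) gL_inj hL_inj ghL capL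
  (fun=> erefl) v w.
have R := @assoc_outer q nu rho pi gR hR (@lower q) (@upper q) gR_inj hR_inj ghR capR
  (fun=> erefl) v w.
rewrite -[LHS]L -(eq_connect (stackC pi (compose nu rho))) -[RHS]R.
exact: (eq_connect (ELR pi nu rho)).
Qed.

Lemma n_middleA pi nu rho :
  (n_middle pi nu + n_middle (compose pi nu) rho
   = n_middle nu rho + n_middle pi (compose nu rho))%N.
Proof.
have L := @assoc_count q pi nu rho gL hL (@upper q) (@lower q) gL_inj hL_inj ghL capL
  covL (fun=> erefl) (fun=> erefl) (fun=> erefl).
have R := @assoc_count q nu rho pi gR hR (@lower q) (@upper q) gR_inj hR_inj ghR capR
  covR (fun=> erefl) (fun=> erefl) (fun=> erefl).
rewrite /n_middle -(eq_count (stackC pi (compose nu rho))) -[LHS]L -[RHS]R.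
exact: (eq_count (ELR pi nu rho)).
Qed.

Definition perm_blocks (s : 'S_q) : {set {set vtx}} :=
  [set [set inl (s i); inr i] | i : 'I_q].

Let label (s : 'S_q) (v : vtx) := match v with inl j => (s^-1)%g j | inr i => i end.

Lemma perm_blocksE s : perm_blocks s = preim_partition (label s) [set: vtx].
Proof.
have blk i : [set inl (s i); inr i] = [set v : vtx | i == label s v].
  apply/setP=> -[j|j]; rewrite !inE /=.
    by rewrite orbF -(canF_eq (permK s)) eq_sym.
  by rewrite eq_sym.
apply/setP=> B; apply/imsetP/imsetP => [[i _ ->]|[v _ ->]].
  by exists (inr i) => //; rewrite blk; apply/setP=> v; rewrite !inE.
by exists (label s v) => //; rewrite blk; apply/setP=> w; rewrite !inE.
Qed.

Lemma perm_blocks_partition s : partition (perm_blocks s) [set: vtx].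
Proof. by rewrite perm_blocksE preim_partitionP. Qed.

Definition perm_part s : setpart q :=
  exist (fun P => is_true (partition P [set: vtx])) (perm_blocks s) (perm_blocks_partition s).

Lemma same_perm s v w : same_block (perm_part s) v w = (label s v == label s w).
Proof.
rewrite /same_block /= perm_blocksE pblock_equivalence_partition ?inE //.
by move=> x y z _ _ _; split=> // /eqP ->.
Qed.

Section Unit.
Variables (nu : setpart q) (o1 o2 : vtx -> W) (col : W -> vtx).
Hypothesis col_o2 : forall v, col (o2 v) = v.
Hypothesis col_o1 : forall v, col (o1 v) = col (o1 (inr (label 1 v))).
Hypothesis col_inl : forall v, col (inl v) = v.
Hypothesis o2_out : forall v, o2 v = inl v \/
  exists i, [/\ inl v = o1 v, o2 v = o1 (inl i) & v = inr i]
         \/ [/\ inl v = o1 v, o2 v = o1 (inr i) & v = inl i].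
Hypothesis mid : forall i, exists v, inr i = o2 v.
Let e := relU (drawn o1 (perm_part 1)) (drawn o2 nu).

Let e_sym : symmetric e.
Proof. by move=> x y; congr (_ || _); exact: drawn_sym. Qed.

Let col_e x y : connect e x y -> same_block nu (col x) (col y).
Proof.
case/connectP=> p; elim: p x => [|z p IH] x /=; first by move=> _ ->; exact: same_blockxx.
case/andP=> xz pz /(IH _ pz); suff: same_block nu (col x) (col z).
  move=> xz'; have [_ /(_ xz') ->] := same_block_equiv nu (col x) (col z) (col y).
  by [].
case/orP: xz => /existsP[v /existsP[w /and3P[/eqP <- /eqP <-]]].
  by rewrite same_perm col_o1 (col_o1 w) => /eqP ->; exact: same_blockxx.
by rewrite !col_o2.
Qed.

Let out_o2 v : connect e (inl v) (o2 v).
Proof.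
case: (o2_out v) => [->|[i [[-> -> ->]|[-> -> ->]]]]; first exact: connect0.
  by apply: connect1; apply/orP; left; apply: drawnP; rewrite same_perm /= invg1 perm1.
by apply: connect1; apply/orP; left; apply: drawnP; rewrite same_perm /= invg1 perm1.
Qed.

Lemma unit_outer v w : connect e (inl v) (inl w) = same_block nu v w.
Proof.
apply/idP/idP; first by move/col_e; rewrite !col_inl.
move=> vw; apply: connect_trans (out_o2 v) _.
rewrite (sym_connect_sym e_sym); apply: connect_trans (out_o2 w) _.
by apply: connect1; apply/orP; right; rewrite drawn_sym; exact: drawnP.
Qed.

Lemma unit_count : n_comp e (in_middle e) = 0%N.
Proof.
apply: eq_card0 => x; rewrite !inE unfold_in; apply: negbTE.
rewrite negb_and; apply/orP; right; apply/negP => /subsetP sub.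
case: x sub => [v|i] sub; first by have := sub _ (connect0 _ _).
have [v dv] := mid i; have := sub (inl v); rewrite !inE.
by rewrite (sym_connect_sym e_sym) dv out_o2 => /(_ isT).
Qed.
End Unit.

Let colL (w : W) : vtx := match w with
  | inl v => v | inr i => inl i end.
Let colR (w : W) : vtx := match w with
  | inl v => v | inr i => inr i end.

Lemma compose1 nu : compose (perm_part 1) nu = nu /\ n_middle (perm_part 1) nu = 0%N.
Proof.
have H1 (v : vtx) : colL (lower v) = v by case: v.
have H2 (v : vtx) : colL (upper v) = colL (upper (inr (label 1 v))).
  by case: v => //= i; rewrite invg1 perm1.
have H4 (v : vtx) : lower v = inl v \/
  exists i, [/\ inl v = upper v, lower v = upper (inl i) & v = inr i]
         \/ [/\ inl v = upper v, lower v = upper (inr i) & v = inl i].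
  by case: v => i; [right; exists i; right | left].
have H5 (i : 'I_q) : exists v : vtx, inr i = lower v by exists (inl i).
split; last exact: (unit_count nu H4 H5).
by apply: setpart_inj => v w; rewrite same_compose; exact: (unit_outer _ H1 H2).
Qed.

Lemma composer1 nu : compose nu (perm_part 1) = nu /\ n_middle nu (perm_part 1) = 0%N.
Proof.
have H1 (v : vtx) : colR (upper v) = v by case: v.
have H2 (v : vtx) : colR (lower v) = colR (lower (inr (label 1 v))).
  by case: v => //= i; rewrite invg1 perm1.
have H4 (v : vtx) : upper v = inl v \/
  exists i, [/\ inl v = lower v, upper v = lower (inl i) & v = inr i]
         \/ [/\ inl v = lower v, upper v = lower (inr i) & v = inl i].
  by case: v => i; [left | right; exists i; left].
have H5 (i : 'I_q) : exists v : vtx, inr i = upper v by exists (inr i).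
split; last by rewrite /n_middle -(eq_count (stackC _ _)); exact: (unit_count nu H4 H5).
apply: setpart_inj => v w; rewrite same_compose /outer_rel.
by rewrite -(eq_connect (stackC _ _)); exact: (unit_outer _ H1 H2).
Qed.
End Monoid.

Section StructureConstants.
Variables (K : fieldType) (V : lmodType K) (I : finType) (x : K).
Variables (mul : V -> V -> V) (d : I -> V) (coord : V -> I -> K).
Variables (comp : I -> I -> I) (c : I -> I -> nat).
Hypothesis mulDl : left_distributive mul +%R.
Hypothesis mulDr : right_distributive mul +%R.
Hypothesis mulZl : forall a p r, a *: mul p r = mul (a *: p) r.
Hypothesis mulZr : forall a p r, a *: mul p r = mul p (a *: r).
Hypothesis dE : forall p, p = \sum_i coord p i *: d i.
Hypothesis mul_d : forall i j, mul (d i) (d j) = x ^+ c i j *: d (comp i j).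
Hypothesis compA : forall i j l, comp (comp i j) l = comp i (comp j l).
Hypothesis cA : forall i j l, (c i j + c (comp i j) l = c j l + c i (comp j l))%N.

Let mul_lincl (a : I -> K) (F : I -> V) r :
  mul (\sum_i a i *: F i) r = \sum_i a i *: mul (F i) r.
Proof.
have f0 : mul 0 r = 0 by rewrite -(scale0r (0 : V)) -mulZl !scale0r.
have fD : {morph mul^~ r : p t / p + t} by move=> p t; exact: mulDl.
by rewrite (big_morph _ fD f0); apply: eq_bigr => i _; rewrite mulZl.
Qed.

Let mul_lincr (a : I -> K) (F : I -> V) r :
  mul r (\sum_i a i *: F i) = \sum_i a i *: mul r (F i).
Proof.
have f0 : mul r 0 = 0 by rewrite -(scale0r (0 : V)) -mulZr !scale0r.
have fD : {morph mul r : p t / p + t} by move=> p t; exact: mulDr.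
by rewrite (big_morph _ fD f0); apply: eq_bigr => i _; rewrite mulZr.
Qed.

Lemma diagram_algA : associative mul.
Proof.
move=> p r t; rewrite (dE p) !mul_lincl; apply: eq_bigr => i _; congr (_ *: _).
rewrite (dE r) mul_lincl !mul_lincr mul_lincl; apply: eq_bigr => j _.
congr (_ *: _); rewrite (dE t) !mul_lincr; apply: eq_bigr => l _.
by congr (_ *: _); rewrite !mul_d -mulZl -mulZr !mul_d !scalerA -!exprD cA compA.
Qed.

Lemma diagram_alg1 o :
  (forall j, comp o j = j /\ c o j = 0%N) -> left_id (d o) mul.
Proof.
move=> oP p; rewrite (dE p) mul_lincr; apply: eq_bigr => j _.
by congr (_ *: _); rewrite mul_d; have [-> ->] := oP j; rewrite scale1r.
Qed.

Lemma diagram_algr1 o :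
  (forall j, comp j o = j /\ c j o = 0%N) -> right_id (d o) mul.
Proof.
move=> oP p; rewrite (dE p) mul_lincl; apply: eq_bigr => j _.
by congr (_ *: _); rewrite mul_d; have [-> ->] := oP j; rewrite scale1r.
Qed.
End StructureConstants.

(* The partition algebra: an element is the family of its coordinates on the basis
   of diagrams. The parameter x only occurs in the product. *)
Definition palg (K : fieldType) (x : K) (q : nat) := {ffun setpart q -> K^o}.

Section PartitionAlgebra.
Variables (K : fieldType) (x : K) (q : nat).

Local Notation palg := (palg x q).
HB.instance Definition _ := Vector.on palg.
Implicit Types (pi nu rho : setpart q) (p r t : palg).

Definition diagram pi : palg := [ffun nu => (nu == pi)%:R].

Definition palg_mul p r : palg :=
  \sum_pi \sum_nu (p pi * r nu) *: (x ^+ n_middle pi nu *: diagram (compose pi nu)).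

Definition palg_one : palg := diagram (perm_part 1).

Lemma palgE p : p = \sum_pi p pi *: diagram pi.
Proof.
have E (F : {ffun setpart q -> K^o}) :
    F = \sum_pi F pi *: ([ffun nu => (nu == pi)%:R] : {ffun setpart q -> K^o}).
  apply/ffunP=> nu; rewrite sum_ffunE (bigD1 nu) //= big1 => [|pi ne].
    by rewrite addr0 !ffunE eqxx /GRing.scale /= mulr1.
  by rewrite !ffunE eq_sym (negPf ne) scaler0.
exact: E.
Qed.

Lemma palg_mulDl : left_distributive palg_mul +%R.
Proof.
move=> p r t; rewrite /palg_mul -big_split; apply: eq_bigr => pi _.
rewrite -big_split; apply: eq_bigr => nu _.
by rewrite ffunE mulrDl scalerDl.
Qed.

Lemma palg_mulDr : right_distributive palg_mul +%R.
Proof.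
move=> p r t; rewrite /palg_mul -big_split; apply: eq_bigr => pi _.
rewrite -big_split; apply: eq_bigr => nu _.
by rewrite ffunE mulrDr scalerDl.
Qed.

Lemma palg_mulZl (a : K) p r : a *: palg_mul p r = palg_mul (a *: p) r.
Proof.
rewrite /palg_mul scaler_sumr; apply: eq_bigr => pi _.
rewrite scaler_sumr; apply: eq_bigr => nu _.
by rewrite [in LHS]scalerA mulrA ffunE.
Qed.

Lemma palg_mulZr (a : K) p r : a *: palg_mul p r = palg_mul p (a *: r).
Proof.
rewrite /palg_mul scaler_sumr; apply: eq_bigr => pi _.
rewrite scaler_sumr; apply: eq_bigr => nu _.
by rewrite [in LHS]scalerA mulrCA ffunE.
Qed.

Lemma diagramE pi nu : diagram pi nu = (nu == pi)%:R.
Proof. exact: ffunE. Qed.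

Lemma palg_mul_diagram pi nu :
  palg_mul (diagram pi) (diagram nu) = x ^+ n_middle pi nu *: diagram (compose pi nu).
Proof.
have delta (mu : setpart q) (F : setpart q -> palg) : \sum_i diagram mu i *: F i = F mu.
  rewrite (bigD1 mu _) // diagramE eqxx scale1r.
  rewrite big1; first exact: addr0.
  move=> i ne.
  by rewrite diagramE (negbTE ne) scale0r.
pose G i j := x ^+ n_middle i j *: diagram (compose i j).
rewrite -[RHS]/(G pi nu) -(delta nu (G pi)) -(delta pi (fun i => \sum_j _ *: G i j)).
apply: eq_bigr => i _; rewrite scaler_sumr; apply: eq_bigr => j _.
exact: (esym (scalerA _ _ _)).
Qed.

Lemma palg_mulA : associative palg_mul.
Proof.
apply: (@diagram_algA K palg (setpart q) x palg_mul diagram (fun p => p)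
  (@compose q) (@n_middle q)).
- exact: palg_mulDl.
- exact: palg_mulDr.
- exact: palg_mulZl.
- exact: palg_mulZr.
- exact: palgE.
- exact: palg_mul_diagram.
- exact: composeA.
- exact: n_middleA.
Qed.

Lemma palg_mul1 : left_id palg_one palg_mul.
Proof.
apply: (@diagram_alg1 K palg (setpart q) x palg_mul diagram (fun p => p)
  (@compose q) (@n_middle q)).
- exact: palg_mulDr.
- exact: palg_mulZr.
- exact: palgE.
- exact: palg_mul_diagram.
- exact: compose1.
Qed.

Lemma palg_mulr1 : right_id palg_one palg_mul.
Proof.
apply: (@diagram_algr1 K palg (setpart q) x palg_mul diagram (fun p => p)
  (@compose q) (@n_middle q)).
- exact: palg_mulDl.
- exact: palg_mulZl.
- exact: palgE.
- exact: palg_mul_diagram.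
- exact: composer1.
Qed.

Lemma palg_one_neq0 : palg_one != 0.
Proof.
by apply/eqP => /ffunP/(_ (perm_part 1)); rewrite !ffunE eqxx => /eqP; rewrite oner_eq0.
Qed.

HB.instance Definition _ := GRing.Zmodule_isNzRing.Build palg
  palg_mulA palg_mul1 palg_mulr1 palg_mulDl palg_mulDr palg_one_neq0.
HB.instance Definition _ := GRing.Lmodule_isLalgebra.Build K palg palg_mulZl.
HB.instance Definition _ := GRing.Lalgebra_isAlgebra.Build K palg palg_mulZr.
HB.instance Definition _ := Algebra_isFalgebra.Build K palg.

Lemma mul_diagram pi nu :
  diagram pi * diagram nu = x ^+ n_middle pi nu *: diagram (compose pi nu) :> palg.
Proof. exact: palg_mul_diagram. Qed.

End PartitionAlgebra.

Local Open Scope mset_scope.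

Section Alphabets.
Variables k m : nat.

(* Plain and barred letters, then their underlined copies. *)
Definition letter := ('I_k + 'I_m)%type.
Definition symb := (letter + letter)%type.

Definition barred (y : symb) : bool :=
  match y with inl (inr _) | inr (inr _) => true | _ => false end.

(* The total order i < \bar j < \underline k < \underline{\bar m}. *)
Definition symb_rank (y : symb) : nat :=
  match y with
  | inl (inl i) => i
  | inl (inr j) => k + j
  | inr (inl i) => k + m + i
  | inr (inr j) => k + m + k + j
  end.

(* Last-letter order on multisets listed in decreasing order: the head is the
   maximum, and the tail is the multiset with one copy of it removed. *)
Fixpoint last_letter_le (s t : seq nat) : bool :=
  match s, t with
  | [::], _ => true
  | _ :: _, [::] => false
  | u :: s', v :: t' => (u < v)%N || (u == v) && last_letter_le s' t'
  end.

Definition block_le (B C : {mset symb}) : bool :=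
  last_letter_le (sort geq [seq symb_rank y | y <- enum_mset B])
                 (sort geq [seq symb_rank y | y <- enum_mset C]).

End Alphabets.

(* Weak compositions of r of length k. *)
Definition wcomp (r k : nat) := {a : k.-tuple nat | sumn a == r}.

Definition part (r k : nat) (a : wcomp r k) (i : 'I_k) : nat := tnth (val a) i.

Section MultisetPartitions.
Variables (r s k m : nat) (a : wcomp r k) (b : wcomp s m).

Local Notation vtx := (vtx (r + s)).
Local Notation symb := (symb k m).
Local Notation mspart := {mset {mset symb}}.

(* The values kappa_{a,b}(1), ..., kappa_{a,b}(r + s). *)
Definition coloring_seq : seq (letter k m) :=
  flatten [seq nseq (part a i) (inl i) | i <- enum 'I_k] ++
  flatten [seq nseq (part b j) (inr j) | j <- enum 'I_m].

Lemma sumn_part (t l : nat) (c : wcomp t l) : sumn [seq part c i | i <- enum 'I_l] = t.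
Proof. by rewrite map_tnth_enum; exact/eqP/(valP c). Qed.

Lemma size_coloring_seq : size coloring_seq == (r + s)%N.
Proof.
have sz (t l : nat) (c : wcomp t l) (f : 'I_l -> letter k m) :
    size (flatten [seq nseq (part c i) (f i) | i <- enum 'I_l]) = t.
  rewrite size_flatten /shape -map_comp -[RHS](sumn_part c); congr sumn.
  by apply: eq_map => i; exact: size_nseq.
by rewrite size_cat !sz.
Qed.

Definition kappa (i : 'I_(r + s)) : letter k m := tnth (Tuple size_coloring_seq) i.

Definition kappa_vtx (v : vtx) : symb :=
  match v with inl i => inl (kappa i) | inr i => inr (kappa i) end.

Definition multiplicity (y : symb) : nat :=
  match y with inl (inl i) | inr (inl i) => part a i
             | inl (inr j) | inr (inr j) => part b j end.

Definition is_mspart (p : mspart) : bool :=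
  (mset0 \notin p) &&
  [forall y : symb, (\sum_(B <- enum_mset p) B y)%N == multiplicity y].

Definition hatPi : pred mspart := fun p =>
  [&& is_mspart p,
      all (fun B : {mset symb} => [forall y : symb, barred y ==> (B y <= 1)%N])
          (enum_mset p)
    & all (fun B : {mset symb} =>
             (1 < p B)%N ==> ~~ odd (\sum_(y : symb | barred y) B y)%N)
          (enum_mset p)].

Section Standardization.
Variable p : mspart.

Definition blocks : seq {mset symb} := sort (@block_le k m) (enum_mset p).

(* For each occurrence of y in the list of blocks, read from left to right, the
   position of the block that contains it. *)
Definition occurrences (y : symb) : seq nat :=
  flatten [seq nseq (nth mset0 blocks j y) j | j <- iota 0 (size blocks)].

(* The preimage of y: its elements all lie in one row, and [enum] lists each row
   in increasing order. *)
Definition fibre (y : symb) : seq vtx := [seq v <- enum {: vtx} | kappa_vtx v == y].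

Definition placed_in (v : vtx) : nat :=
  nth 0%N (occurrences (kappa_vtx v)) (index v (fibre (kappa_vtx v))).

Definition standardization : setpart (r + s) :=
  exist _ (preim_partition placed_in [set: vtx]) (preim_partitionP placed_in [set: vtx]).

End Standardization.

Definition young : {set 'S_(r + s)} :=
  [set g : 'S_(r + s) | [forall i, kappa (g i) == kappa i]].

(* The component tau of g = sigma tau. *)
Definition barred_part (g : 'S_(r + s)) : 'S_(r + s) :=
  restr_perm [set i : 'I_(r + s) | (r <= i)%N] g.

Section OverC.
Variable R : realType.

Definition ratfun := {fraction {poly R[i]}}.
Definition indet : ratfun := tofrac ('X : {poly R[i]}).

Local Notation P := (palg indet (r + s)).

Definition e_ab : P :=
  (#|young|%:R : ratfun)^-1 *:
    \sum_(g in young) ((-1) ^+ barred_part g : ratfun) *: diagram indet (perm_part g).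

Definition MP : {vspace P} := limg (amulr e_ab \o amull e_ab)%VF.

Lemma mem_MP (v : P) : reflect (exists p : P, v = e_ab * p * e_ab) (v \in MP).
Proof.
apply: (iffP memv_imgP) => [[p _ ->]|[p ->]]; exists p; rewrite ?memvf //.
  by rewrite comp_lfunE !lfunE.
by rewrite comp_lfunE !lfunE.
Qed.

Definition Dhat (p : mspart) : P := e_ab * diagram indet (standardization p) * e_ab.

End OverC.
End MultisetPartitions.

(* Main.v *)
Require Import Defs.
From mathcomp Require Import all_boot all_order all_fingroup all_algebra all_field.
From mathcomp Require Import finmap multiset complex reals.

Set Implicit Arguments.
Unset Strict Implicit.
Unset Printing Implicit Defensive.

Import GRing.Theory.
Local Open Scope ring_scope.
Local Open Scope mset_scope.

(** Let [Y] be the group of permutations of the vertices of a diagram that preserve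
    the coloring by [kappa_vtx]. Since the two rows carry different symbols, such a
    permutation acts on each row separately, so [Y] is the product of two copies of
    the Young subgroup ([color_perms_rows]). Multiplying a diagram on both sides by
    permutation diagrams only relabels its rows ([perm_diagram_perm]); therefore,
    up to a nonzero scalar, [e * diagram pi * e] is the signed sum of the orbit of
    [pi] under [Y], the sign being that of the action on barred vertices
    ([e_diagram_e]).

    Everything now reduces to orbits. Two set partitions are in the same orbit if
    and only if they have the same multiset of colored blocks ([part_colors_moved],
    [same_colors_moved]), and then their signed orbit sums agree up to sign
    ([signed_orbit_moved]). A signed orbit sum vanishes if the stabilizer contains an
    odd element; otherwise it is nonzero at each point of the orbit. The conditions
    that define the index set say exactly that the stabilizer is even: a repeated
    barred symbol in a block gives an odd transposition, two equal blocks with an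
    odd number of barred entries give an odd exchange ([stab_odd]), and conversely
    a stabilizing permutation is a composite of exchanges of blocks with an even
    number of barred entries, as far as barred vertices are concerned
    ([stab_even]).

    As standardization picks a representative of each orbit ([standardizationK]),
    the elements [Dhat p] are, up to a nonzero scalar, the nonzero signed orbit
    sums, one for each orbit that has one. They
    span because diagrams span the partition algebra, and they are free because
    distinct orbits are disjoint and the field has characteristic zero. *)

(** * Permutations of a finite type *)

Section Permutations.
Variable V : finType.
Implicit Types (A D : {set V}) (f t : {perm V}).

Lemma count_map_enum (C : eqType) (a : V -> C) (A : {set V}) (d : C) :
  count_mem d [seq a v | v <- enum A] = #|[set v in A | a v == d]|.
Proof.
rewrite count_map -size_filter cardE; apply: perm_size; apply: uniq_perm.
- exact/filter_uniq/enum_uniq.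
- exact: enum_uniq.
by move=> v; rewrite mem_filter !mem_enum [in RHS]inE andbC.
Qed.

(** Two functions that take every value equally often differ by a permutation of
    their domain: match the elements of each fibre. *)
Lemma perm_matching (C : eqType) (a a' : V -> C) :
  (forall d, #|[set v | a v == d]| = #|[set v | a' v == d]|) ->
  exists f : {perm V}, forall v, a' (f v) = a v.
Proof.
move=> card_fib; pose tup (c : V -> C) := map_tuple c (enum_tuple V).
have cnt c d : count_mem d (tup c) = #|[set v | c v == d]|.
  rewrite /= (eq_enum (B := [set: V])) => [|v]; last by rewrite !inE.
  by rewrite count_map_enum; apply: eq_card => v; rewrite !inE.
have /tuple_permP[p eq_tup] : perm_eq (tup a) (tup a').
  by apply/allP=> d _; rewrite /= !cnt card_fib.
pose f v := enum_val (p (enum_rank v)).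
have f_inj : injective f by move=> v w /enum_val_inj/perm_inj/enum_rank_inj.
exists (perm f_inj) => v; rewrite permE /f.
have tupE c i : tnth (tup c) i = c (enum_val i).
  by rewrite tnth_map (tnth_nth (enum_val i)) -enum_val_nth.
rewrite -tupE -[in RHS](enum_rankK v) -tupE.
have -> : tup a = [tuple tnth (tup a') (p i) | i < _] by apply: val_inj.
by rewrite tnth_mktuple.
Qed.

(** The involution that exchanges [A] with its image under [f], provided these two
    sets are disjoint. *)
Definition swap_fun A f v :=
  if v \in A then f v else if (f^-1)%g v \in A then (f^-1)%g v else v.

(** The exchange is a product of one transposition [(x, f x)] for each [x] in [A],
    whence its sign. *)
Lemma swap_perm A f : [disjoint A & f @: A] ->
  exists2 t : {perm V}, t =1 swap_fun A f & odd_perm t = odd #|A|.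
Proof.
move: {2}#|A| (erefl #|A|) => n; elim: n A => [|n IH] A.
  move/cards0_eq=> -> _; exists 1%g; last by rewrite cards0 odd_perm1.
  by move=> v; rewrite /swap_fun !inE perm1.
move=> cardA disA; have /card_gt0P[x xA] : (0 < #|A|)%N by rewrite cardA.
have fA v : v \in A -> f v \notin A.
  by move=> vA; rewrite (disjointFl disA) // imset_f.
have [||t tE odd_t] := IH (A :\ x).
- by have := cardsD1 x A; rewrite xA cardA => -[].
- apply: disjointWl (subsetDl _ _) (disjointWr _ disA).
  exact/imsetS/subsetDl.
exists (tperm x (f x) * t)%g; last first.
  rewrite odd_mul_tperm odd_t (cardsD1 x A) xA /=.
  by case: eqP => // xfx; have := fA x xA; rewrite -xfx xA.
move=> v; rewrite permM tE /swap_fun; case: tpermP => [->|->|/eqP vx /eqP vfx].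
- by rewrite !inE permK eqxx (negPf (fA _ xA)) andbF /= xA.
- rewrite permK !inE eqxx (negPf (fA _ xA)) /= xA.
  case: ifP => // /andP[_ fxA]; by have := fA _ fxA; rewrite permKV xA.
rewrite !inE vx /=.
by have -> : (f^-1)%g v != x by rewrite (canF_eq (permKV f)).
Qed.

(** Let [f] permute [D], respecting the colors [c] and the blocks of [p], where no
    color is repeated inside a block. If every block that [f] moves has even
    size, then [f] is even. Indeed, when [f] moves the block [A] of [x], the
    exchange of [A] and [f @: A] is a product of an even number of transpositions,
    and composing [f] with it gives a permutation which satisfies the same
    hypotheses and fixes all of [A]; induction on the number of moved points
    applies. *)
Lemma even_block_perm (B C : eqType) (D : {set V}) (p : V -> B) (c : V -> C) f :
  perm_on D f ->
  {in D, forall v, c (f v) = c v} ->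
  {in D &, forall v w, (p (f v) == p (f w)) = (p v == p w)} ->
  {in D &, forall v w, p v = p w -> c v = c w -> v = w} ->
  {in D, forall v, p (f v) != p v -> ~~ odd #|[set w in D | p w == p v]|} ->
  ~~ odd_perm f.
Proof.
move: {2}#|[set v | f v != v]|.+1 (ltnSn #|[set v | f v != v]|) => n.
elim: n f => // n IH f; rewrite ltnS => le_n fD cf pf inj ev.
have memf v : (f v \in D) = (v \in D) by exact: perm_closed.
case: (set_0Vmem [set v | f v != v]) => [fix_f|[x]].
  suff -> : f = 1%g by rewrite odd_perm1.
  apply/permP=> v; rewrite perm1; apply/eqP/negbNE.
  by move/setP/(_ v): fix_f; rewrite !inE => ->.
rewrite inE => fx; have xD : x \in D by apply: contraR fx => /(out_perm fD) ->.
have pfx : p (f x) != p x.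
  by apply: contra fx => /eqP pe; apply/eqP/inj; rewrite ?memf ?cf.
pose A := [set w in D | p w == p x].
have AD w : w \in A -> w \in D by rewrite inE => /andP[].
have disA : [disjoint A & f @: A].
  rewrite disjoint_sym; apply/pred0P => w /=; apply: negbTE; rewrite negb_and.
  rewrite -implybE; apply/implyP=> /imsetP[u uA ->].
  rewrite inE memf (AD _ uA) /=; move: uA; rewrite inE => /andP[uD].
  by rewrite -(pf _ _ uD xD) => /eqP ->.
have [t tE odd_t] := swap_perm disA.
have tfA v : v \in A -> t (f v) = v.
  by move=> vA; rewrite tE /swap_fun permK vA (disjointFl disA) ?imset_f.
have tN v : v \notin A -> (f^-1)%g v \notin A -> t v = v.
  by move=> vA fvA; rewrite tE /swap_fun (negPf vA) (negPf fvA).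
have tA v : v \in A -> t v = f v by move=> vA; rewrite tE /swap_fun vA.
have odd_f : odd_perm (f * t)%g = odd_perm f.
  by rewrite odd_permM odd_t (negPf (ev _ xD pfx)) addbF.
have pftA v : v \in A -> p (f v) = p (f x).
  move=> vA; apply/eqP; rewrite (pf _ _ (AD _ vA)) //; by move: vA; rewrite inE => /andP[].
(* On blocks, the exchange [t] acts as the transposition of the classes of [x] and [f x]. *)
pose sg b := if b == p x then p (f x) else if b == p (f x) then p x else b.
have sg_inj : injective sg.
  apply: inv_inj => b; rewrite /sg; case: (eqVneq b (p x)) => [->|nb].
    by rewrite (negPf pfx) eqxx.
  by case: (eqVneq b (p (f x))) => [->|nb']; rewrite ?eqxx // (negPf nb) (negPf nb').
have fVD u : ((f^-1)%g u \in D) = (u \in D) by rewrite -memf permKV.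
have fVA u : u \in D -> ((f^-1)%g u \in A) = (p u == p (f x)).
  by move=> uD; rewrite -[in RHS](permKV f u) pf ?fVD // inE fVD uD.
have pt u : u \in D -> p (t u) = sg (p u).
  move=> uD; have uA : (u \in A) = (p u == p x) by rewrite inE uD.
  rewrite /sg -uA -fVA //; case: ifP => [inA|nuA]; first by rewrite tA // pftA.
  case: ifP => fuA; last by rewrite tN ?nuA ?fuA.
  rewrite -{1}(permKV f u) tfA //; apply/eqP.
  by move: fuA; rewrite inE => /andP[].
rewrite -odd_f; apply: IH.
- apply: leq_trans le_n; apply: proper_card; apply/properP; split; last first.
    by exists x; rewrite !inE // permM tfA ?eqxx // inE xD eqxx.
  apply/subsetP=> v; rewrite !inE permM; apply: contra => /eqP fv.
  have nvA : v \notin A by apply/negP => vA; have := disjointFl disA (imset_f f vA); rewrite fv vA.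
  by rewrite fv tN // -fv permK.
- apply/subsetP=> v; rewrite inE permM; apply: contraR => nvD.
  rewrite (out_perm fD nvD) tN ?(contraNN (AD v)) ?eqxx //.
  by apply: contra nvD => /AD; rewrite fVD.
- move=> v vD; rewrite permM tE /swap_fun.
  case: ifP => [/AD fvD|_]; first by rewrite cf ?memf ?cf.
  by rewrite permK; case: ifP => // _; rewrite cf.
- move=> v w vD wD; rewrite !permM !pt ?memf // (inj_eq sg_inj); exact: pf.
- exact: inj.
move=> v vD pv; apply: ev => //; apply: contra pv => /eqP pe.
rewrite permM pt ?memf // pe /sg; case: (p v =P p x) => [pvx|_].
  by rewrite -pe pf // pvx.
by case: (p v =P p (f x)) => // pvx; rewrite eq_sym -pf // pe pvx.
Qed.

End Permutations.

(** A morphism of symmetric groups that sends transpositions to odd permutations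
    preserves signs, since transpositions generate. *)
Lemma odd_perm_morph (S T : finType) (F : {perm S} -> {perm T}) :
  (F 1 = 1)%g -> {morph F : g h / (g * h)%g >-> (g * h)%g} ->
  (forall i j, i != j -> odd_perm (F (tperm i j))) ->
  forall g, odd_perm (F g) = odd_perm g.
Proof.
move=> F1 FM Ft g; have [ts -> dts] := prod_tpermP g.
rewrite odd_perm_prod //; elim: ts dts => [_|[i j] ts IH] /=; first by rewrite big_nil F1 odd_perm1.
by case/andP=> /= ij /IH odd_ts; rewrite big_cons FM odd_permM odd_ts Ft.
Qed.

(** * Relabelled diagrams *)

Section Diagrams.
Variable q : nat.
Local Notation vtx := (vtx q).
Implicit Types (pi nu : setpart q) (v w : vtx) (g h : 'S_q) (f : {perm vtx}).

Lemma same_blockE pi v w :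
  same_block pi v w = (pblock (val pi) v == pblock (val pi) w).
Proof.
have [/eqP cov triv _] := and3P (valP pi).
by rewrite /same_block eq_pblock // cov inE.
Qed.

Lemma pblock_in pi v : pblock (val pi) v \in val pi.
Proof. by have [/eqP cov _ _] := and3P (valP pi); rewrite pblock_mem // cov inE. Qed.

Lemma mem_pblock_self pi v : v \in pblock (val pi) v.
Proof. exact: same_blockxx. Qed.

Lemma pblockP pi (B : {set vtx}) v : B \in val pi -> v \in B -> pblock (val pi) v = B.
Proof. by have [_ triv _] := and3P (valP pi); exact: def_pblock. Qed.

Lemma pblock_eq pi (B : {set vtx}) v :
  B \in val pi -> (pblock (val pi) v == B) = (v \in B).
Proof.
by move=> B_in; apply/eqP/idP => [<-|/pblockP->//]; exact: mem_pblock_self.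
Qed.

Lemma block_neq0 pi (B : {set vtx}) : B \in val pi -> exists v, v \in B.
Proof.
have [_ _ not0] := and3P (valP pi); move=> B_in; apply/set0Pn.
by apply: contra not0 => /eqP <-.
Qed.

(** The direction is chosen so that relations pull back along [f]; hence the
    blocks of [moved f pi] are the preimages under [f] of the blocks of [pi], and
    [moved] is a right-to-left action (see [moved_moved]). *)
Definition moved f pi : setpart q :=
  exist _ (preim_partition (fun v => pblock (val pi) (f v)) [set: vtx])
    (preim_partitionP _ _).

Lemma same_moved f pi v w : same_block (moved f pi) v w = same_block pi (f v) (f w).
Proof.
rewrite [RHS]same_blockE /same_block /= pblock_equivalence_partition ?inE //.
by move=> x y z _ _ _; split=> // /eqP ->.
Qed.

Lemma moved_moved f f' pi : moved f (moved f' pi) = moved (f * f')%g pi.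
Proof. by apply: setpart_inj => v w; rewrite !same_moved !permM. Qed.

Lemma moved1 pi : moved 1 pi = pi.
Proof. by apply: setpart_inj => v w; rewrite same_moved !perm1. Qed.

Definition row_fun g h v : vtx := match v with inl i => inl (g i) | inr i => inr (h i) end.

Lemma row_fun_inj g h : injective (row_fun g h).
Proof. by move=> [i|i] [j|j] //= [/perm_inj ->]. Qed.

Definition row_perm g h : {perm vtx} := perm (@row_fun_inj g h).

Lemma row_permE g h v : row_perm g h v = row_fun g h v.
Proof. exact: permE. Qed.

Lemma row_permM g h g' h' :
  row_perm (g * g') (h * h') = (row_perm g h * row_perm g' h')%g.
Proof. by apply/permP=> -[i|i]; rewrite permM !row_permE /= permM. Qed.

Lemma row_perm1 : row_perm 1 1 = 1%g.
Proof. by apply/permP=> -[i|i]; rewrite row_permE /= !perm1. Qed.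

Lemma odd_row_perm g h : odd_perm (row_perm g h) = odd_perm g (+) odd_perm h.
Proof.
have -> : row_perm g h = (row_perm g 1 * row_perm 1 h)%g by rewrite -row_permM mulg1 mul1g.
rewrite odd_permM; congr (_ (+) _).
- apply: (odd_perm_morph (F := row_perm^~ 1%g)) => [|g' g''|i j ij].
  + exact: row_perm1.
  + by rewrite -row_permM mulg1.
  have -> : row_perm (tperm i j) 1 = tperm (inl i) (inl j); last by rewrite odd_tperm.
  apply/permP=> -[l|l]; rewrite row_permE /=; last by rewrite perm1 tpermD.
  by rewrite (inj_tperm (f := inl)) // => ? ? [].
- apply: (odd_perm_morph (F := row_perm 1%g)) => [|g' g''|i j ij].
  + exact: row_perm1.
  + by rewrite -row_permM mulg1.
  have -> : row_perm 1 (tperm i j) = tperm (inr i) (inr j); last by rewrite odd_tperm.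
  apply/permP=> -[l|l]; rewrite row_permE /=; first by rewrite perm1 tpermD.
  by rewrite (inj_tperm (f := inr)) // => ? ? [].
Qed.

(** In a stacked graph where one diagram is a permutation, every vertex slides along
    an edge of the permutation diagram to a vertex of the other diagram [pi]:
    [col] records which one, and [lift] places [pi] in the stacked graph.
    Connectedness is then read off [pi] alone. *)
Lemma connect_retract (W : finType) (e : rel W) pi (col : W -> vtx) (lift : vtx -> W) :
  symmetric e ->
  (forall x y, e x y -> same_block pi (col x) (col y)) ->
  (forall x, connect e x (lift (col x))) ->
  (forall v w, same_block pi v w -> connect e (lift v) (lift w)) ->
  forall x y, connect e x y = same_block pi (col x) (col y).
Proof.
move=> e_sym e_col to_lift lift_e x y; apply/idP/idP.
  case/connectP=> p; elim: p x => [|z p IH] x /=; first by move=> _ ->; exact: same_blockxx.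
  case/andP=> /e_col xz /IH zy /zy; move: xz.
  by rewrite !same_blockE => /eqP->.
move/lift_e => lxy; apply: connect_trans (to_lift x) (connect_trans lxy _).
by rewrite (sym_connect_sym e_sym).
Qed.

Lemma n_comp0 (A B : finType) (e : rel (A + B)) : symmetric e ->
  (forall j : B, exists i : A, connect e (inr j) (inl i)) ->
  n_comp e (in_middle e) = 0%N.
Proof.
move=> e_sym to_outer; apply: eq_card0 => x; rewrite !inE unfold_in; apply: negbTE.
rewrite negb_and; apply/orP; right; apply/negP => /subsetP sub.
case: x sub => [i|j] sub; first by have := sub _ (connect0 _ _).
by have [i ji] := to_outer j; have := sub _ ji; rewrite !inE.
Qed.

(** A permutation diagram stacked above [pi] only relabels the top row of [pi], and
    closes no component in the middle row, as it joins each middle vertex to a top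
    vertex. *)
Lemma compose_perm g pi :
  compose (perm_part g) pi = moved (row_perm g^-1 1) pi /\ n_middle (perm_part g) pi = 0%N.
Proof.
pose e := stacked (perm_part g) pi.
have e_sym : symmetric e := @stacked_sym q _ _.
have up i : e (inl (inl (g i))) (inr i).
  apply/orP; left; apply: (drawnP (@upper q) (v := inl (g i)) (w := inr i)).
  by rewrite same_perm /= permK.
have lo v w : same_block pi v w -> e (lower v) (lower w).
  by move=> vw; apply/orP; right; exact: drawnP.
pose col (x : vtx + 'I_q) : vtx :=
  match x with inl (inl i) => inl ((g^-1)%g i) | inl (inr i) => inr i | inr i => inl i end.
have e_conn : forall x y, connect e x y = same_block pi (col x) (col y).
  apply: (connect_retract (lift := @lower q)) => //.
  - move=> x y /orP[]/existsP[v /existsP[w /and3P[/eqP<- /eqP<-]]].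
      rewrite same_perm; case: v => i; case: w => j /= /eqP; move=> ->; exact: same_blockxx.
    by case: v => i; case: w.
  - case=> [[i|i]|i] /=; [|exact: connect0..].
    by apply: connect1; rewrite -{1}(permKV g i); exact: up.
  - by move=> v w /lo vw; apply: connect1; exact: vw.
split; last first.
  apply: n_comp0 => // i; exists (inl (g i)).
  by rewrite (sym_connect_sym e_sym); apply: connect1; exact: up.
apply: setpart_inj => v w; rewrite same_compose /outer_rel e_conn same_moved !row_permE.
by case: v => i; case: w => j; rewrite /= ?perm1.
Qed.

Lemma composer_perm pi h :
  compose pi (perm_part h) = moved (row_perm 1 h) pi /\ n_middle pi (perm_part h) = 0%N.
Proof.
pose e := stacked pi (perm_part h).
have e_sym : symmetric e := @stacked_sym q _ _.
have lo i : e (inr (h i)) (inl (inr i)).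
  apply/orP; right; apply: (drawnP (@lower q) (v := inl (h i)) (w := inr i)).
  by rewrite same_perm /= permK.
have up v w : same_block pi v w -> e (upper v) (upper w).
  by move=> vw; apply/orP; left; exact: drawnP.
pose col (x : vtx + 'I_q) : vtx :=
  match x with inl (inl i) => inl i | inl (inr i) => inr (h i) | inr i => inr i end.
have e_conn : forall x y, connect e x y = same_block pi (col x) (col y).
  apply: (connect_retract (lift := @upper q)) => //.
  - move=> x y /orP[]/existsP[v /existsP[w /and3P[/eqP<- /eqP<-]]].
      by case: v => i; case: w.
    rewrite same_perm; case: v => i; case: w => j /= /eqP.
    + by move/perm_inj->; exact: same_blockxx.
    + by move <-; rewrite permKV; exact: same_blockxx.
    + by move ->; rewrite permKV; exact: same_blockxx.
    + by move ->; exact: same_blockxx.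
  - case=> [[i|i]|i] /=; [exact: connect0| |exact: connect0].
    by apply: connect1; rewrite e_sym; exact: lo.
  - by move=> v w /up vw; apply: connect1; exact: vw.
split; last first.
  apply: n_comp0 => // i; exists (inr ((h^-1)%g i)).
  by rewrite -{1}(permKV h i); apply: connect1; exact: lo.
apply: setpart_inj => v w; rewrite same_compose /outer_rel e_conn same_moved !row_permE.
by case: v => i; case: w => j; rewrite /= ?perm1.
Qed.

Lemma perm_diagram_perm (K : fieldType) (x : K) g h pi :
  diagram x (perm_part g) * diagram x pi * diagram x (perm_part h)
  = diagram x (moved (row_perm g^-1 h) pi).
Proof.
have [cl nl] := compose_perm g pi.
rewrite mul_diagram nl cl expr0 scale1r.
have [cr nr] := composer_perm (moved (row_perm g^-1 1) pi) h.
by rewrite mul_diagram nr cr expr0 scale1r moved_moved -row_permM mul1g mulg1.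
Qed.

End Diagrams.

(** * Colored set partitions *)

Section ColoredPartitions.
Variables (q : nat) (C : choiceType) (c : vtx q -> C) (bar : pred C).
Local Notation vtx := (vtx q).
Implicit Types (pi nu : setpart q) (v w : vtx) (f : {perm vtx}) (B : {set vtx}).

Definition block_colors B : {mset C} := seq_mset [seq c v | v <- enum B].

Definition part_colors pi : {mset {mset C}} :=
  seq_mset [seq block_colors B | B <- enum (val pi)].

Lemma block_colorsE B d : block_colors B d = #|[set v in B | c v == d]|.
Proof. by rewrite mset_seqE count_map_enum. Qed.

Lemma part_colorsE pi T : part_colors pi T = #|[set B in val pi | block_colors B == T]|.
Proof. by rewrite mset_seqE count_map_enum. Qed.

Definition color_perms : {set {perm vtx}} := [set f : {perm vtx} | [forall v, c (f v) == c v]].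

Lemma color_permsP f : reflect (forall v, c (f v) = c v) (f \in color_perms).
Proof. by rewrite inE; apply: (iffP forallP) => cf v; apply/eqP. Qed.

Lemma color_perms_group : group_set color_perms.
Proof.
apply/group_setP; split=> [|f f' /color_permsP cf /color_permsP cf'].
  by apply/color_permsP => v; rewrite perm1.
by apply/color_permsP => v; rewrite permM cf' cf.
Qed.
Canonical color_perms_groupType := Group color_perms_group.

Lemma block_colors_imset f B : f \in color_perms -> block_colors (f @: B) = block_colors B.
Proof.
move/color_permsP=> cf; apply/msetP => d; rewrite !block_colorsE.
rewrite -[RHS](card_imset _ (@perm_inj _ f)); apply: eq_card => v.
rewrite -[v](permKV f) mem_imset; last exact: perm_inj.
by rewrite !inE mem_imset ?cf //; exact: perm_inj.
Qed.

Lemma moved_blocks f pi : val (moved f pi) = [set f @^-1: B | B : {set vtx} in val pi].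
Proof.
have pbE v : pblock (val (moved f pi)) v = f @^-1: pblock (val pi) (f v).
  by apply/setP => w; rewrite inE; exact: same_moved.
apply/setP=> B; apply/idP/imsetP => [Bin|[B' B'in ->]].
  have [v vB] := block_neq0 Bin; exists (pblock (val pi) (f v)); first exact: pblock_in.
  by rewrite -pbE (pblockP Bin vB).
have [w wB'] := block_neq0 B'in.
rewrite -(pblockP B'in wB') -[w](permKV f) -pbE; exact: pblock_in.
Qed.

Lemma part_colors_moved f pi : f \in color_perms -> part_colors (moved f pi) = part_colors pi.
Proof.
move=> fY; apply/msetP => T; rewrite !part_colorsE moved_blocks.
have pre_inj : injective (fun B => f @^-1: B).
  move=> B B' /setP eqB; apply/setP => v.
  by have := eqB ((f^-1)%g v); rewrite !inE permKV.
have bcV B : block_colors (f @^-1: B) = block_colors B.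
  rewrite -(block_colors_imset _ fY); congr block_colors; apply/setP => v.
  by rewrite -[v](permKV f) mem_imset ?inE //; exact: perm_inj.
rewrite -[RHS](card_imset _ pre_inj); apply: eq_card => B; rewrite inE.
apply/andP/imsetP => [[/imsetP[B' B'in ->]]|[B' + ->]].
  by rewrite bcV => colB'; exists B'; rewrite // inE B'in.
by rewrite inE bcV => /andP[B'in ->]; rewrite imset_f.
Qed.

(** Conversely, equality of the multisets of colored blocks yields a color-preserving
    matching of the blocks, and equality of the colors of matched blocks then
    yields a matching of the vertices inside them. *)
Lemma same_colors_moved pi nu : part_colors pi = part_colors nu ->
  exists2 f, f \in color_perms & moved f nu = pi.
Proof.
move=> eq_cols.
(* The value [None] on sets that are not blocks makes a matching of all sets of vertices
   restrict to a matching of the blocks. *)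
pose a pi' B := if B \in val pi' then Some (block_colors B) else None.
have card_some pi' T : #|[set B | a pi' B == Some T]| = part_colors pi' T.
  rewrite part_colorsE; apply: eq_card => B; rewrite !inE /a.
  by case: ifP.
have card_none pi' : #|[set B | a pi' B == None]| = (#|{set vtx}| - #|val pi'|)%N.
  rewrite -(cardC (mem (val pi'))) addKn; apply: eq_card => B; rewrite !inE /a.
  by case: ifP.
have card_eq : #|val pi| = #|val nu|.
  by move/eq_seq_msetP: eq_cols => /perm_size; rewrite !size_map -!cardE.
have [be beE] : exists be : {perm {set vtx}}, forall B, a nu (be B) = a pi B.
  apply: perm_matching => -[T|]; first by rewrite !card_some eq_cols.
  by rewrite !card_none card_eq.
have be_in B : (be B \in val nu) = (B \in val pi).
  by have := beE B; rewrite /a; case: ifP; case: ifP.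
have be_col B : B \in val pi -> block_colors (be B) = block_colors B.
  by move=> Bin; have := beE B; rewrite /a be_in Bin => -[].
have [f fE] : exists f : {perm vtx}, forall v,
    (pblock (val nu) (f v), c (f v)) = (be (pblock (val pi) v), c v).
  apply: (perm_matching (a' := fun v => (pblock (val nu) v, c v))
                        (a := fun v => (be (pblock (val pi) v), c v))) => -[B d].
  rewrite -[B](permKV be); move: ((be^-1)%g B) => {}B.
  case: (boolP (B \in val pi)) => Bin.
    transitivity (block_colors B d); last rewrite -be_col //;
      rewrite block_colorsE; apply: eq_card => v; rewrite !inE xpair_eqE.
      by rewrite (inj_eq perm_inj) pblock_eq.
    by rewrite pblock_eq ?be_in.
  rewrite !eq_card0 // => v; rewrite !inE xpair_eqE; apply/negP => /andP[/eqP eB _].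
    by move: Bin; rewrite -be_in -eB pblock_in.
  by move: Bin; rewrite -(perm_inj eB) pblock_in.
exists f; first by apply/color_permsP => v; case: (fE v).
apply: setpart_inj => v w; rewrite same_moved !same_blockE.
by have [-> _] := fE v; have [-> _] := fE w; rewrite (inj_eq perm_inj).
Qed.

Definition barred_set : {set vtx} := [set v | bar (c v)].

(** On a pair of elements of the Young subgroup this is the product of the two signs
    by which [e_ab] weights them (see [perm_sign_row]). *)
Definition perm_sign f : bool := odd_perm (restr_perm barred_set f).

Lemma color_perms_stab f : f \in color_perms -> f \in 'N(barred_set | 'P)%g.
Proof.
by move/color_permsP=> cf; apply/astabsP => v; rewrite /= !inE cf.
Qed.

Lemma perm_signM : {in color_perms &, {morph perm_sign : f f' / (f * f')%g >-> f (+) f'}}.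
Proof.
move=> f f' fY f'Y; rewrite /perm_sign morphM ?odd_permM //; exact: color_perms_stab.
Qed.

(** The conditions defining the index set of the basis, read on a set partition
    instead of on its multiset of colored blocks. *)
Definition admissible pi : bool :=
  [forall v in barred_set, forall w in barred_set,
     same_block pi v w && (c v == c w) ==> (v == w)] &&
  [forall B in val pi, forall B' in val pi,
     (B != B') && (block_colors B == block_colors B') ==> ~~ odd #|B :&: barred_set|].

(** A permutation that stabilizes [pi] permutes the blocks among those of the same
    colors. On the barred vertices, whose colors determine them inside a block, a
    block that moves has a twin, hence an even number of barred vertices, so
    [even_block_perm] applies. *)
Lemma stab_even pi f : admissible pi -> f \in color_perms -> moved f pi = pi ->
  perm_sign f = false.
Proof.
case/andP=> /'forall_in_forall_inP inj /'forall_in_forall_inP ev fY stab.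
have cf := color_permsP _ fY.
have fblk v w : same_block pi (f v) (f w) = same_block pi v w by rewrite -same_moved stab.
have pE v : pblock (val pi) (f v) = f @: pblock (val pi) v.
  apply/setP=> w; rewrite -[w](permKV f) mem_imset; last exact: perm_inj.
  exact: fblk.
have rE v : v \in barred_set -> restr_perm barred_set f v = f v.
  by move=> vD; rewrite restr_permE ?color_perms_stab.
apply/negbTE/(even_block_perm (D := barred_set) (c := c) (p := pblock (val pi))).
- exact: restr_perm_on.
- by move=> v vD; rewrite rE.
- by move=> v w vD wD; rewrite !rE // -!same_blockE fblk.
- move=> v w vD wD pvw cvw; apply/eqP; move: (inj v vD w wD).
  by rewrite same_blockE pvw cvw !eqxx.
move=> v vD; rewrite rE // => mv.
have := ev _ (pblock_in pi v) _ (pblock_in pi (f v)); rewrite eq_sym mv pE block_colors_imset //.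
rewrite eqxx /=; congr (~~ odd _); apply: eq_card => w; rewrite !inE andbC.
by rewrite pblock_eq ?pblock_in.
Qed.

(** Matching on the triple (membership in [B], membership in [B'], color), with the
    roles of [B] and [B'] exchanged in the target, gives a permutation carrying
    [B] onto [B'] without changing colors. *)
Lemma same_colors_matching B B' : (forall v, (v \in B) && (v \in B') = false) ->
  block_colors B = block_colors B' ->
  exists2 f, f \in color_perms & forall v, (f v \in B') = (v \in B).
Proof.
move=> disB eqc.
pose side (X Y : {set vtx}) v := ((v \in X), (v \in Y), c v).
have side_card (X Y : {set vtx}) x y d : (forall v, (v \in X) && (v \in Y) = false) ->
  #|[set v | side X Y v == (x, y, d)]| =
  if x then (if y then 0%N else block_colors X d) else if y then block_colors Y d
  else (#|[set v | c v == d]| - (block_colors X d + block_colors Y d))%N.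
  move=> dis; rewrite !block_colorsE.
  have sideE v : (v \in [set v | side X Y v == (x, y, d)]) =
      [&& (v \in X) == x, (v \in Y) == y & c v == d].
    by rewrite inE !xpair_eqE andbA.
  have splitE := cardsUI [set v in X | c v == d] [set v in Y | c v == d].
  rewrite [X in (_ + #|pred_of_set X|)%N](_ : _ = set0) ?cards0 ?addn0 in splitE; last first.
    apply/setP=> v; rewrite !inE; have := dis v.
    by case: (v \in X); case: (v \in Y); rewrite /= ?andbF.
  rewrite -splitE; case: x sideE => sideE; case: y sideE => sideE.
  - by apply: eq_card0 => v; rewrite sideE; have := dis v; case: (v \in X); case: (v \in Y).
  - by apply: eq_card => v; rewrite sideE inE; have := dis v; case: (v \in X); case: (v \in Y).
  - by apply: eq_card => v; rewrite sideE inE; have := dis v; case: (v \in X); case: (v \in Y).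
  rewrite -(cardsID ([set v in X | c v == d] :|: [set v in Y | c v == d]) [set v | c v == d]).
  rewrite (setIidPr _); last first.
    by apply/subsetP=> v; rewrite !inE => /orP[]/andP[].
  rewrite addKn; apply: eq_card => v; rewrite sideE !inE.
  by case: (v \in X); case: (v \in Y); case: (c v == d).
have [f fE] : exists f : {perm vtx}, forall v, side B' B (f v) = side B B' v.
  apply: perm_matching => -[[x y] d].
  rewrite !side_card //; last by move=> v; rewrite andbC disB.
  by rewrite eqc.
exists f; first by apply/color_permsP => v; case: (fE v).
by move=> v; case: (fE v).
Qed.

(** If a barred color is repeated inside a block, transpose two vertices that carry
    it; if two blocks of the same colors have an odd number of barred vertices,
    exchange them. *)
Lemma stab_odd pi : ~~ admissible pi ->
  exists f, [/\ f \in color_perms, moved f pi = pi & perm_sign f].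
Proof.
rewrite negb_and => /orP[].
  case/forall_inPn=> v vD /forall_inPn[w wD]; rewrite negb_imply => /andP[/andP[vw /eqP cvw] nvw].
  have tY : tperm v w \in color_perms.
    by apply/color_permsP => u; case: tpermP => [->|->|].
  exists (tperm v w); split=> //.
    have pt u : pblock (val pi) (tperm v w u) = pblock (val pi) u.
      by move: vw; rewrite same_blockE => /eqP vw; case: tpermP => [->|->|] //.
    by apply: setpart_inj => u u'; rewrite same_moved !same_blockE !pt.
  rewrite /perm_sign.
  have -> : restr_perm barred_set (tperm v w) = tperm v w; last by rewrite odd_tperm.
  apply/permP => u; case: (boolP (u \in barred_set)) => uD.
    by rewrite restr_permE ?color_perms_stab.
  rewrite (out_perm (restr_perm_on _ _) uD) tpermD //.
    by apply: contraNneq uD => <-.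
  by apply: contraNneq uD => <-.
case/forall_inPn=> B Bin /forall_inPn[B' B'in]; rewrite negb_imply negbK.
move=> /andP[/andP[nBB' /eqP eqc] oddB].
have disB v : (v \in B) && (v \in B') = false.
  apply/negP=> /andP[vB vB']; move: nBB'.
  by rewrite -(pblockP Bin vB) (pblockP B'in vB') eqxx.
have [f /color_permsP cf fB] := same_colors_matching disB eqc.
have imB : f @: B = B'.
  by apply/setP=> v; rewrite -[v](permKV f) mem_imset ?fB //; exact: perm_inj.
have fV v : ((f^-1)%g v \in B) = (v \in B') by rewrite -fB permKV.
have cfV v : c ((f^-1)%g v) = c v by rewrite -[in RHS](permKV f v) cf.
have [|t tE _] := @swap_perm _ B f.
  by rewrite imB; apply/pred0P => v; exact: disB.
(* The barred part of the exchange of [B] and [B'] is the exchange of their barred parts. *)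
have [|t' t'E odd_t'] := @swap_perm _ (B :&: barred_set) f.
  rewrite -imB in disB; apply/pred0P => v /=; apply: contraFF (disB v) => /andP[].
  by rewrite inE => /andP[-> _] /imsetP[w /setIP[wB _] ->]; rewrite imset_f.
have tY : t \in color_perms.
  by apply/color_permsP => v; rewrite tE /swap_fun; case: ifP => // _; case: ifP.
exists t; split=> //.
  pose sg (X : {set vtx}) := if X == B then B' else if X == B' then B else X.
  have sg_inj : injective sg.
    apply: inv_inj => X; rewrite /sg; case: (eqVneq X B) => [->|nX].
      by rewrite eq_sym (negPf nBB') eqxx.
    by case: (eqVneq X B') => [->|nX']; rewrite ?eqxx // (negPf nX) (negPf nX').
  have pt v : pblock (val pi) (t v) = sg (pblock (val pi) v).
    rewrite tE /swap_fun /sg !pblock_eq // fV; case: ifP => [vB|_].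
      by rewrite (pblockP B'in) // fB.
    by case: ifP => // vB'; rewrite (pblockP Bin) // fV.
  by apply: setpart_inj => v w; rewrite same_moved !same_blockE !pt (inj_eq sg_inj).
rewrite /perm_sign; have -> : restr_perm barred_set t = t'; last by rewrite odd_t'.
apply/permP => v; rewrite t'E /swap_fun !inE.
case: (boolP (v \in barred_set)) => vD.
  rewrite restr_permE ?color_perms_stab // tE /swap_fun.
  by move: vD; rewrite inE => vD; rewrite cfV vD !andbT.
rewrite (out_perm (restr_perm_on _ _) vD).
by move: vD; rewrite inE => vD; rewrite cfV (negPf vD) !andbF.
Qed.

End ColoredPartitions.

(** * Signed sums over orbits *)

Section SignedOrbits.
Variables (q : nat) (C : choiceType) (c : vtx q -> C) (bar : pred C).
Variables (K : fieldType) (x : K).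
Hypothesis char0 : forall n, (n%:R == 0 :> K) = (n == 0)%N.
Implicit Types (pi nu : setpart q) (f : {perm vtx q}).
Local Notation Y := (color_perms c).
Local Notation sign := (perm_sign c bar).

Definition signed_orbit pi : palg x q :=
  \sum_(f in Y) ((-1) ^+ sign f : K) *: diagram x (moved f pi).

Lemma signed_orbit_moved f pi : f \in Y ->
  signed_orbit (moved f pi) = ((-1) ^+ sign f : K) *: signed_orbit pi.
Proof.
move=> fY; rewrite /signed_orbit [in RHS](reindex_inj (mulIg f)) scaler_sumr.
apply: eq_big => [f'|f' f'Y]; first by rewrite groupMr.
rewrite moved_moved scalerA perm_signM // signr_addb mulrCA -expr2 sqrr_sign mulr1.
by [].
Qed.

(** An odd element of the stabilizer gives [S = - S]. *)
Lemma signed_orbit_eq0 pi : ~~ admissible c bar pi -> signed_orbit pi = 0.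
Proof.
case/stab_odd=> f [fY stab odd_f].
have /eqP := signed_orbit_moved pi fY; rewrite stab odd_f expr1 scaleN1r.
rewrite -subr_eq0 opprK -mulr2n -scaler_nat scaler_eq0 char0 /=.
by move/eqP.
Qed.

Lemma signed_orbitE pi nu :
  signed_orbit pi nu = \sum_(f in Y | moved f pi == nu) (-1) ^+ sign f.
Proof.
rewrite /signed_orbit.
have -> (F : {perm vtx q} -> palg x q) : (\sum_(f in Y) F f) nu = \sum_(f in Y) F f nu.
  exact: sum_ffunE.
rewrite big_mkcondr /=; apply: eq_bigr => f _.
rewrite ffunE diagramE eq_sym.
by case: eqP => _; rewrite /GRing.scale /= ?mulr1 ?mulr0.
Qed.

Lemma signed_orbit_supp pi nu :
  part_colors c pi != part_colors c nu -> signed_orbit pi nu = 0.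
Proof.
move=> ne; rewrite signed_orbitE big1 // => f /andP[fY /eqP mv].
by case/eqP: ne; rewrite -mv part_colors_moved.
Qed.

(** No cancellation occurs: the coefficient is the order of the stabilizer, all of
    whose elements are even. *)
Lemma signed_orbit_self pi : admissible c bar pi -> signed_orbit pi pi != 0.
Proof.
move=> adm; rewrite signed_orbitE.
rewrite (eq_bigr (fun=> 1)) => [|f /andP[fY /eqP stab]]; last first.
  by rewrite (stab_even adm fY stab).
rewrite sumr_const char0 -lt0n; apply/card_gt0P; exists 1%g.
by rewrite unfold_in /= group1 moved1 eqxx.
Qed.

End SignedOrbits.

(** * Color patterns and standardization *)

Section Standardization.
Variables (r s k m : nat) (a : wcomp r k) (b : wcomp s m).
Local Notation vtx := (vtx (r + s)).
Local Notation symb := (symb k m).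
Local Notation mspart := {mset {mset symb}}.
Local Notation kv := (kappa_vtx a b).

Lemma barred_kappa (i : 'I_(r + s)) :
  (if kappa a b i is inr _ then true else false) = (r <= i)%N.
Proof.
pose s1 := flatten [seq nseq (part a i) (inl i : letter k m) | i <- enum 'I_k].
pose s2 := flatten [seq nseq (part b j) (inr j : letter k m) | j <- enum 'I_m].
have sz1 : size s1 = r.
  rewrite size_flatten /shape -map_comp -[RHS](sumn_part a); congr sumn.
  by apply: eq_map => j; exact: size_nseq.
have sz : size (s1 ++ s2) = (r + s)%N by apply/eqP; exact: size_coloring_seq.
have -> : kappa a b i = nth (kappa a b i) (s1 ++ s2) i.
  by rewrite {1}/kappa (tnth_nth (kappa a b i)).
rewrite nth_cat sz1 [RHS]leqNgt; case: ltnP => [lt_ir|le_ri].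
  have /flatten_mapP[j _] : nth (kappa a b i) s1 i \in s1 by rewrite mem_nth ?sz1.
  by rewrite mem_nseq => /andP[_ /eqP->].
have /flatten_mapP[j _] : nth (kappa a b i) s2 (i - r) \in s2.
  by rewrite mem_nth // ltn_subLR //; move: sz; rewrite size_cat sz1 => ->.
by rewrite mem_nseq => /andP[_ /eqP->].
Qed.

Lemma barred_kappa_vtx (v : vtx) :
  barred (kv v) = (r <= match v with inl i => i | inr i => i end)%N.
Proof. by case: v => i; rewrite -barred_kappa /=; case: (kappa a b i). Qed.

Lemma card_kappa_fibre (y : symb) : #|[set v | kv v == y]| = multiplicity a b y.
Proof.
have cardk (l : letter k m) : #|[set i | kappa a b i == l]| =
    match l with inl i => part a i | inr j => part b j end.
  have -> : #|[set i | kappa a b i == l]| = count_mem l (coloring_seq a b).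
    rewrite -[coloring_seq a b](map_tnth_enum (Tuple (size_coloring_seq a b))).
    rewrite (eq_enum (B := [set: 'I_(r + s)])) => [|i]; last by rewrite !inE.
    by rewrite count_map_enum; apply: eq_card => i; rewrite !inE.
  rewrite /coloring_seq count_cat !count_flatten -!map_comp !sumnE !big_map -!enumT !big_enum /=.
  case: l => j.
    rewrite (bigD1 j) //= count_nseq /= eqxx mul1n !big1 ?addn0 // => i ne_ij;
      rewrite count_nseq //=.
    by case: eqP => // -[dj]; rewrite dj eqxx in ne_ij.
  rewrite addnC (bigD1 j) //= count_nseq /= eqxx mul1n !big1 ?addn0 // => i ne_ij;
      rewrite count_nseq //=.
  by case: eqP => // -[dj]; rewrite dj eqxx in ne_ij.
case: y => l; rewrite -[RHS]cardk.
  have inlI : injective (@inl 'I_(r + s) 'I_(r + s)) by move=> ? ? [].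
  rewrite -[RHS](card_imset _ inlI); apply: eq_card => -[i|i]; rewrite !inE.
    by rewrite (mem_imset _ _ inlI) inE.
  by apply/esym/imsetP => -[].
have inrI : injective (@inr 'I_(r + s) 'I_(r + s)) by move=> ? ? [].
rewrite -[RHS](card_imset _ inrI); apply: eq_card => -[i|i]; rewrite !inE.
  by apply/esym/imsetP => -[].
by rewrite (mem_imset _ _ inrI) inE.
Qed.

Lemma size_fibre (y : symb) : size (fibre a b y) = multiplicity a b y.
Proof.
rewrite -card_kappa_fibre cardE; apply: perm_size; apply: uniq_perm.
- exact/filter_uniq/enum_uniq.
- exact: enum_uniq.
by move=> v; rewrite mem_filter !mem_enum [in RHS]inE andbT.
Qed.

Section OfMultisetPartition.
Variable p : mspart.
Hypothesis p_part : is_mspart a b p.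
Local Notation n := (size (blocks p)).
Local Notation blk := (nth mset0 (blocks p)).

Lemma perm_eq_blocks : perm_eq (blocks p) (enum_mset p).
Proof. by rewrite /blocks perm_sort. Qed.

Lemma size_occurrences y : size (occurrences p y) = multiplicity a b y.
Proof.
case/andP: p_part => _ /forallP/(_ y)/eqP <-.
rewrite -(perm_big _ perm_eq_blocks) /= size_flatten /shape -map_comp sumnE big_map.
rewrite (big_nth mset0) /index_iota subn0; apply: eq_bigr => j _.
exact: size_nseq.
Qed.

Lemma count_occurrences y j : (j < n)%N -> count_mem j (occurrences p y) = blk j y.
Proof.
move=> lt_jn; rewrite count_flatten -map_comp sumnE big_map.
rewrite (bigD1_seq j) ?iota_uniq ?mem_iota //= count_nseq /= eqxx mul1n.
rewrite big1 ?addn0 // => i ne_ij; rewrite count_nseq /=.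
by rewrite (negPf ne_ij).
Qed.

(** The fibre of [y] has as many elements as [y] has occurrences in [p], so that the
    default value of [nth] in [placed_in] is never reached. *)
Lemma map_placed_in y : [seq placed_in a b p v | v <- fibre a b y] = occurrences p y.
Proof.
apply: (@eq_from_nth _ 0%N) => [|i]; first by rewrite size_map size_fibre size_occurrences.
rewrite size_map => lt_i; have v0 : vtx by case: (fibre a b y) lt_i => // v0.
rewrite (nth_map v0) // /placed_in.
have : nth v0 (fibre a b y) i \in fibre a b y by rewrite mem_nth.
rewrite mem_filter => /andP[/eqP-> _]; rewrite index_uniq //.
exact/filter_uniq/enum_uniq.
Qed.

Lemma placed_in_lt v : (placed_in a b p v < n)%N.
Proof.
have : placed_in a b p v \in occurrences p (kv v).
  by rewrite -map_placed_in map_f // mem_filter eqxx mem_enum.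
case/flatten_mapP=> j; rewrite mem_iota add0n => /= lt_jn.
by rewrite mem_nseq => /andP[_ /eqP->].
Qed.

Let S j : {set vtx} := [set v | placed_in a b p v == j].

Lemma placed_colors j : (j < n)%N -> block_colors kv (S j) = blk j.
Proof.
move=> lt_jn; apply/msetP=> y; rewrite block_colorsE -count_occurrences // -map_placed_in.
rewrite count_map -size_filter cardE; apply: perm_size; apply: uniq_perm.
- exact: enum_uniq.
- by do 2!apply: filter_uniq; exact: enum_uniq.
by move=> v; rewrite mem_enum 2!mem_filter mem_enum !inE andbT.
Qed.

(** The vertices placed in the [j]-th block have the colors of that block; as no block
    of [p] is empty, they form a block of the standardization. *)
Lemma standardizationK : part_colors kv (standardization a b p) = p.
Proof.
have Sneq0 j : (j < n)%N -> exists v, v \in S j.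
  move=> lt_jn; apply/set0Pn; apply: contraL lt_jn => /eqP S0.
  apply/negP=> lt_jn; case/andP: p_part => /negP[].
  rewrite -(perm_mem perm_eq_blocks).
  have -> : mset0 = blk j; last exact: mem_nth.
  rewrite -placed_colors // S0; apply/msetP=> y.
  by rewrite block_colorsE mset0E eq_card0 // => v; rewrite !inE.
have enumE : perm_eq (enum (val (standardization a b p))) [seq S j | j <- iota 0 n].
  apply: uniq_perm; first exact: enum_uniq.
    rewrite map_inj_in_uniq ?iota_uniq // => i j; rewrite !mem_iota => /= lt_in _ eqS.
    have [v vi] := Sneq0 _ lt_in; have vj := vi; rewrite eqS in vj.
    by move: vi vj; rewrite !inE => /eqP-> /eqP.
  move=> B; rewrite mem_enum; apply/imsetP/mapP => [[v _ ->]|[j]].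
    exists (placed_in a b p v); first by rewrite mem_iota placed_in_lt.
    by apply/setP=> w; rewrite !inE eq_sym.
  rewrite mem_iota => /= lt_jn ->; have [v] := Sneq0 _ lt_jn; rewrite inE => /eqP vj.
  exists v; rewrite ?inE //; apply/setP=> w; rewrite !inE vj; exact: eq_sym.
rewrite -[RHS]seq_mset_id; apply/eq_seq_msetP.
apply: perm_trans (perm_map _ enumE) _; rewrite -map_comp.
apply: perm_trans perm_eq_blocks.
rewrite -[X in perm_eq _ X](mkseq_nth mset0) /mkseq.
suff /eq_in_map -> : {in iota 0 n, block_colors kv \o S =1 nth mset0 (blocks p)} by [].
by move=> j; rewrite mem_iota => /= lt_jn; exact: placed_colors.
Qed.
End OfMultisetPartition.

Lemma is_mspart_colors pi : is_mspart a b (part_colors kv pi).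
Proof.
have perm_en := perm_eq_seq_mset [seq block_colors kv B | B <- enum (val pi)].
apply/andP; split.
  rewrite (perm_mem perm_en); apply/mapP => -[B]; rewrite mem_enum => /block_neq0[v vB].
  move/msetP/(_ (kv v))/eqP; rewrite mset0E block_colorsE eq_sym cards_eq0.
  by move/eqP/setP/(_ v); rewrite !inE vB eqxx.
apply/forallP=> y; rewrite (perm_big _ perm_en) /= big_map big_enum /= -card_kappa_fibre.
rewrite (eq_bigr (fun B : {set vtx} => #|[set v in B | kv v == y]|)) => [|B _]; last first.
  exact: block_colorsE.
have eqp B v : B \in val pi -> (v \in B) = (pblock (val pi) v == B).
  by move=> Bin; rewrite pblock_eq.
rewrite -sum1_card (partition_big (fun v => pblock (val pi) v) (mem (val pi))) /=; last first.
  by move=> v _; exact: pblock_in.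
apply/eqP; apply: eq_bigr => B Bin; rewrite -sum1_card; apply: eq_bigl => v.
by rewrite !inE eqp // andbC.
Qed.

Lemma sum_barred_colors (B : {set vtx}) :
  (\sum_(y : symb | barred y) block_colors kv B y)%N = #|B :&: barred_set kv (@barred k m)|.
Proof.
rewrite -sum1_card (partition_big kv (@barred k m)) /=; last by move=> v /setIP[_]; rewrite inE.
apply: eq_bigr => y bary; rewrite block_colorsE -sum1_card; apply: eq_bigl => v.
by rewrite !inE; case: eqP => [->|]; rewrite ?andbF // bary !andbT.
Qed.

(** A block of colors occurs more than once exactly when two distinct blocks of the
    set partition carry it. *)
Lemma hatPi_colors pi : hatPi a b (part_colors kv pi) = admissible kv (@barred k m) pi.
Proof.
have perm_en := perm_eq_seq_mset [seq block_colors kv B | B <- enum (val pi)].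
rewrite /hatPi is_mspart_colors /=; congr (_ && _).
  apply/allP/'forall_in_forall_inP => [norep v vD w wD|inj T].
    apply/implyP=> /andP[vw /eqP cvw].
    have Bin : block_colors kv (pblock (val pi) v) \in enum_mset (part_colors kv pi).
      by rewrite (perm_mem perm_en) map_f // mem_enum pblock_in.
    have /forallP/(_ (kv v)) := norep _ Bin.
    have -> : barred (kv v) by move: vD; rewrite inE.
    rewrite block_colorsE => /card_le1_eqP/(_ v w) ->; rewrite ?inE ?eqxx ?mem_pblock_self //.
    by rewrite cvw eqxx andbT.
  rewrite (perm_mem perm_en) => /mapP[B]; rewrite mem_enum => Bin ->.
  apply/forallP=> y; apply/implyP=> bary; rewrite block_colorsE; apply/card_le1_eqP => w v.
  rewrite !inE => /andP[wB /eqP cw] /andP[vB /eqP cv].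
  apply/eqP; move: (inj v); rewrite inE cv bary => /(_ isT w).
  by rewrite inE cw bary eqxx same_blockE (pblockP Bin vB) (pblockP Bin wB) eqxx => /(_ isT).
apply/allP/'forall_in_forall_inP => [ev B Bin B' B'in|ev T].
  apply/implyP=> /andP[nBB' /eqP eqc].
  have Bm : block_colors kv B \in enum_mset (part_colors kv pi).
    by rewrite (perm_mem perm_en) map_f // mem_enum.
  have := ev _ Bm; rewrite sum_barred_colors => /implyP; apply.
  rewrite part_colorsE; apply/card_gt1P; exists B, B'.
  by split=> //; rewrite inE ?Bin ?B'in ?eqc eqxx.
rewrite (perm_mem perm_en) => /mapP[B]; rewrite mem_enum => Bin ->.
apply/implyP; rewrite part_colorsE sum_barred_colors.
case/card_gt1P=> B1 [B2 []]; rewrite !inE => /andP[B1in /eqP c1] /andP[B2in /eqP c2] n12.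
have [eB|nB] := eqVneq B B1.
  by have /implyP -> := ev _ Bin _ B2in; rewrite // c2 eqxx eB n12.
by have /implyP -> := ev _ Bin _ B1in; rewrite // c1 eqxx nB.
Qed.

End Standardization.

(** * The basis of signed orbit sums *)

Section AlgebraSums.
Variables (K : fieldType) (V : algType K) (I : finType).

Lemma mul_sum_sum (A : {set I}) (c : I -> K) (z : K) (d : I -> V) (t : V) :
  (z *: \sum_(i in A) c i *: d i) * t * (z *: \sum_(i in A) c i *: d i) =
  z ^+ 2 *: \sum_(i in A) \sum_(j in A) (c i * c j) *: (d i * t * d j).
Proof.
rewrite -!scalerAl -scalerAr scalerA -expr2; congr (_ *: _).
rewrite !mulr_suml; apply: eq_bigr => i _; rewrite mulr_sumr; apply: eq_bigr => j _.
by rewrite -!scalerAl -scalerAr scalerA.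
Qed.

Lemma mul_lincomb_mul (c : I -> K) (d : I -> V) (t : V) :
  t * (\sum_i c i *: d i) * t = \sum_i c i *: (t * d i * t).
Proof.
rewrite mulr_sumr mulr_suml; apply: eq_bigr => i _.
by rewrite -scalerAr -scalerAl.
Qed.

End AlgebraSums.

Section SignedSums.
Variables (R : realType) (r s k m : nat) (a : wcomp r k) (b : wcomp s m).
Local Notation vtx := (vtx (r + s)).
Local Notation kv := (kappa_vtx a b).
Local Notation bar := (@barred k m).
Local Notation Y := (young a b).
Local Notation P := (palg (indet R) (r + s)).
Implicit Types (pi : setpart (r + s)) (g h : 'S_(r + s)).

Lemma ratfun_char0 n : (n%:R == 0 :> ratfun R) = (n == 0)%N.
Proof.
rewrite -tofrac1 -tofracMn tofrac_eq0.
by rewrite -polyCMn polyC_eq0 Num.Theory.pnatr_eq0.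
Qed.

Lemma youngP g : reflect (forall i, kappa a b (g i) = kappa a b i) (g \in Y).
Proof. by rewrite inE; apply: (iffP forallP) => Yg i; apply/eqP. Qed.

Lemma young_group : group_set Y.
Proof.
apply/group_setP; split=> [|g h /youngP Yg /youngP Yh]; apply/youngP => i.
  by rewrite perm1.
by rewrite permM Yh Yg.
Qed.
Canonical young_groupType := Group young_group.

(** Letters and underlined letters being distinct symbols, a color-preserving
    permutation of the vertices preserves the rows. *)
Lemma color_perms_rows :
  color_perms kv = [set row_perm gh.1 gh.2 | gh in setX Y Y].
Proof.
have inlr_row f (i : 'I_(r + s)) : f \in color_perms kv ->
    (exists j, f (inl i) = inl j) /\ (exists j, f (inr i) = inr j).
  move/color_permsP=> cf; split.
    by have := cf (inl i); case: (f (inl i)) => j //; exists j.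
  by have := cf (inr i); case: (f (inr i)) => j //; exists j.
apply/setP=> f; apply/idP/imsetP => [fY|[[g h] /setXP[/= /youngP Yg /youngP Yh] ->]]; last first.
  by apply/color_permsP; case=> i; rewrite row_permE /= ?Yg ?Yh.
pose top i := if f (inl i) is inl j then j else i.
pose bot i := if f (inr i) is inr j then j else i.
have topE i : f (inl i) = inl (top i).
  by rewrite /top; have [[j ->] _] := inlr_row f i fY.
have botE i : f (inr i) = inr (bot i).
  by rewrite /bot; have [_ [j ->]] := inlr_row f i fY.
have top_inj : injective top.
  by move=> i j eq_ij; have := topE i; rewrite eq_ij -topE => /perm_inj[].
have bot_inj : injective bot.
  by move=> i j eq_ij; have := botE i; rewrite eq_ij -botE => /perm_inj[].
have cf := color_permsP _ _ fY.
exists (perm top_inj, perm bot_inj).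
  apply/setXP; split; apply/youngP => i; rewrite permE.
    by have := cf (inl i); rewrite topE => -[].
  by have := cf (inr i); rewrite botE => -[].
by apply/permP=> -[i|i]; rewrite row_permE /= permE ?topE ?botE.
Qed.

Lemma young_stab g : g \in Y -> g \in 'N([set i : 'I_(r + s) | (r <= i)%N] | 'P)%g.
Proof.
move/youngP=> Yg; apply/astabsP => i; rewrite /= !inE.
by rewrite -!(barred_kappa a b) /aperm Yg.
Qed.

(** The barred letters color exactly the last [s] positions of each row, so that taking
    the barred part can be done row by row. *)
Lemma perm_sign_row g h : g \in Y -> h \in Y ->
  perm_sign kv bar (row_perm g h) = barred_part g (+) barred_part h.
Proof.
move=> Yg Yh; rewrite -odd_row_perm /perm_sign; congr odd_perm.
have rowY : row_perm g h \in color_perms kv.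
  by rewrite color_perms_rows; apply/imsetP; exists (g, h); rewrite // in_setX Yg.
apply/permP=> v; case: (boolP (v \in barred_set kv bar)) => vD.
  rewrite restr_permE ?color_perms_stab // !row_permE.
  move: vD; rewrite inE barred_kappa_vtx; case: v => i /= ri;
    by rewrite /barred_part restr_permE ?young_stab // inE.
rewrite (out_perm (restr_perm_on _ _) vD) row_permE.
move: vD; rewrite inE barred_kappa_vtx; case: v => i /= ri;
  by rewrite /barred_part (out_perm (restr_perm_on _ _)) // inE.
Qed.

(** Expanding both factors [e_ab] produces a sum over pairs of permutations of the two
    rows; inverting the left one, which changes neither its sign nor the range of
    summation, turns it into a sum over the color-preserving permutations. *)
Lemma e_diagram_e pi :
  e_ab a b R * diagram (indet R) pi * e_ab a b R =
  ((#|Y|%:R : ratfun R)^-1 ^+ 2) *: signed_orbit kv bar (indet R) pi.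
Proof.
have bpV g : g \in Y -> barred_part g^-1 = (barred_part g)^-1%g.
  by move=> gY; rewrite /barred_part morphV ?young_stab.
pose F g h : P := ((-1) ^+ perm_sign kv bar (row_perm g h) : ratfun R) *:
  diagram (indet R) (moved (row_perm g h) pi).
rewrite /e_ab; etransitivity; first exact: (mul_sum_sum (V := P)).
congr (_ *: _); transitivity (\sum_(g in Y) \sum_(h in Y) F g h).
  rewrite [RHS](reindex_inj invg_inj) /=.
  apply: eq_big => [g|g gY]; first by rewrite groupV.
  apply: eq_bigr => h hY; rewrite /F perm_sign_row ?groupV // signr_addb.
  rewrite (bpV g gY) odd_permV.
  congr (_ *: _).
  exact: perm_diagram_perm.
rewrite pair_big /signed_orbit color_perms_rows big_imset /=; last first.
  move=> [g h] [g' h'] _ _ /= /permP eq_row; congr (_, _); apply/permP=> i.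
    by have := eq_row (inl i); rewrite !row_permE => -[].
  by have := eq_row (inr i); rewrite !row_permE => -[].
by apply: eq_bigl => -[g h]; rewrite in_setX.
Qed.

Lemma hatPi_mspart p : hatPi a b p -> is_mspart a b p.
Proof. by rewrite /hatPi => /and3P[]. Qed.

Definition hat_parts : seq {mset {mset symb k m}} :=
  undup [seq p <- [seq part_colors kv pi | pi <- enum {: setpart (r + s)}] | hatPi a b p].

(** Every element of the index set is the color pattern of its standardization. *)
Lemma mem_hat_parts p : (p \in hat_parts) = hatPi a b p.
Proof.
rewrite mem_undup mem_filter; case hat_p: (hatPi a b p) => //=.
apply/mapP; exists (standardization a b p); first by rewrite mem_enum.
by rewrite standardizationK ?hatPi_mspart.
Qed.

Lemma hat_parts_colors p : p \in hat_parts -> part_colors kv (standardization a b p) = p.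
Proof. by rewrite mem_hat_parts => /hatPi_mspart; exact: standardizationK. Qed.

Lemma hat_parts_admissible p :
  p \in hat_parts -> admissible kv bar (standardization a b p).
Proof.
by move=> p_in; rewrite -hatPi_colors (hat_parts_colors p_in) -mem_hat_parts.
Qed.

Lemma Dhat_orbit : exists2 z : ratfun R, z != 0 &
  forall p, Dhat a b R p = z *: signed_orbit kv bar (indet R) (standardization a b p).
Proof.
exists ((#|Y|%:R)^-1 ^+ 2) => [|p]; last exact: e_diagram_e.
rewrite expf_neq0 // invr_neq0 // ratfun_char0 -lt0n.
by apply/card_gt0P; exists 1%g; exact: group1.
Qed.

(** The elements have pairwise disjoint supports, each containing the standardization
    that indexes it: reading the coordinates of a vanishing linear combination at
    the standardizations isolates its coefficients. *)
Lemma Dhat_free : free [seq Dhat a b R p | p <- hat_parts].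
Proof.
have [z z_neq0 DE] := Dhat_orbit.
have coordZ (y : ratfun R) (p : P) nu : (y *: p) nu = y * p nu by rewrite ffunE.
have coord0 nu : (0 : P) nu = 0 by rewrite ffunE.
apply/(@freeP _ _ _ (in_tuple _)) => coef sum0 i; move: coef sum0 i.
rewrite /= size_map => coef sum0 i.
pose p0 : {mset {mset symb k m}} := mset0.
have := congr1 (fun t : P => t (standardization a b (nth p0 hat_parts i))) sum0.
have -> (F : 'I_(size hat_parts) -> P) nu : (\sum_j F j) nu = \sum_j F j nu
  by exact: sum_ffunE.
rewrite (bigD1 i) //= big1 => [|j ne_ji].
  rewrite (nth_map p0) // DE !coordZ addr0 => /eqP; rewrite coord0 !mulf_eq0 (negPf z_neq0).
  have := signed_orbit_self (indet R) ratfun_char0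
    (hat_parts_admissible (mem_nth p0 (ltn_ord i))).
  by move/negPf=> ->; rewrite !orbF => /eqP.
rewrite (nth_map p0) // DE !coordZ signed_orbit_supp ?mulr0 // !hat_parts_colors ?mem_nth //.
by rewrite nth_uniq ?undup_uniq.
Qed.

(** The algebra is spanned by the elements [e * diagram pi * e]; such an element
    vanishes when [pi] is not admissible, and otherwise equals, up to sign, the one
    obtained from the standardization of the color pattern of [pi]. *)
Lemma Dhat_span : (<<[seq Dhat a b R p | p <- hat_parts]>> = MP a b R)%VS.
Proof.
apply/subv_anti/andP; split.
  apply/span_subvP => v /mapP[p _ ->]; apply/mem_MP.
  by exists (diagram (indet R) (standardization a b p)).
apply/subvP=> v /mem_MP[p ->].
have -> : e_ab a b R * p * e_ab a b R =
    \sum_pi p pi *: (e_ab a b R * diagram (indet R) pi * e_ab a b R).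
  by rewrite {1}(palgE p); exact: (mul_lincomb_mul (V := P)).
apply: memv_suml => pi _; rewrite memvZ //.
case: (boolP (admissible kv bar pi)) => [adm|nadm]; last first.
  by rewrite e_diagram_e (signed_orbit_eq0 _ ratfun_char0 nadm) scaler0 mem0v.
have col_in : part_colors kv pi \in hat_parts by rewrite mem_hat_parts hatPi_colors.
have [f fY <-] : exists2 f, f \in color_perms kv &
    moved f (standardization a b (part_colors kv pi)) = pi.
  by apply: same_colors_moved; rewrite hat_parts_colors.
rewrite e_diagram_e signed_orbit_moved // scalerA mulrC -scalerA memvZ // -e_diagram_e.
exact/memv_span/(map_f (Dhat a b R)).
Qed.

End SignedSums.

Theorem theorem4p5 (R : realType) (r s k m : nat) (a : wcomp r k) (b : wcomp s m) :
  exists2 u : seq {mset {mset symb k m}},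
    uniq u /\ u =i hatPi a b &
    basis_of (MP a b R) [seq Dhat a b R p | p <- u].
Proof.
exists (hat_parts a b).
  by split; [exact: undup_uniq | exact: mem_hat_parts].
by rewrite /basis_of Dhat_span eqxx Dhat_free.
Qed.
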